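(* Assume $R>1$ and that the model is uniformly well-posed, i.e. there is a constant $C>0$ with $\eta\ge C$ on $E$. Then there exists a global solution $f:E\to(0,\infty)$, $f\in C^2(E)$, of $$0=\tfrac12 b^2f''+\tilde a f'-R\eta f+Rf^{1-\frac1R}+\tfrac12\tfrac{1-R}{R}\rho^2b^2\frac{(f')^2}{f}\quad\text{on }E.$$
   Context: $E\subseteq\mathbb R$ is an open interval. $r,\lambda,\sigma,a,b,\rho,\delta:E\to\mathbb R$ are locally Lipschitz with $\sigma>0$, $b(y)\neq0$ and $\rho(y)\in[-1,1]$ for all $y$; $R\in(0,\infty)\setminus\{1\}$ is a constant. Define $\eta=\frac1R\big(\delta-(1-R)(r+\frac{\lambda^2}{2R})\big)$ and $\tilde a=a+\frac{1-R}{R}\rho\lambda b$. (These arise from a stochastic factor $dY=a(Y)dt+b(Y)d\tilde W$ correlated with the stock's Brownian motion with correlation $\rho(Y)$; the displayed equation is the reduced HJB equation for the value function ansatz $V=\frac{x^{1-R}}{1-R}f(y)$.) *)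

(* Defs.v *)
From Stdlib Require Import Reals.
From Coquelicot Require Import Coquelicot.
Open Scope R_scope.

Definition in_interval (lo hi : Rbar) (y : R) : Prop :=
  Rbar_lt lo y /\ Rbar_lt y hi.

Definition loc_lipschitz_on (lo hi : Rbar) (g : R -> R) : Prop :=
  forall y, in_interval lo hi y ->
    exists eps L, 0 < eps /\
      forall x z, in_interval lo hi x -> in_interval lo hi z ->
        Rabs (x - y) < eps -> Rabs (z - y) < eps ->
        Rabs (g x - g z) <= L * Rabs (x - z).

Definition C2_on (lo hi : Rbar) (f : R -> R) : Prop :=
  forall y, in_interval lo hi y ->
    ex_derive f y /\ ex_derive (Derive f) y /\
    continuous (Derive (Derive f)) y.

Definition eta_fun (Rc : R) (r lam delta : R -> R) (y : R) : R :=
  / Rc * (delta y - (1 - Rc) * (r y + (lam y) ^ 2 / (2 * Rc))).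

Definition atilde_fun (Rc : R) (a rho lam b : R -> R) (y : R) : R :=
  a y + (1 - Rc) / Rc * rho y * lam y * b y.

(* Main.v *)
(* With [f = exp (R v)] the equation becomes [v'' = - k v'^2 - A v' + B (eta - exp (-v))] with
   [1 <= k] and [B > 0]. On a compact interval, clamping the arguments of the right-hand side makes
   it bounded and Lipschitz, and shooting solves the Dirichlet problem with both boundary values
   [M = ln (2 / C)]. The maximum principle gives [m <= v <= M], hence [v' <= 0] and [v' >= 0] at
   the left and right ends, and the term [- k v'^2] then keeps [|v'|] below the clamping level, so
   the clamps are inactive. Along an exhaustion of the interval these solutions stay below [M];
   the Riccati inequality for [v'] bounds [|v'|] locally, independently of the solution, and then
   [exp (-v)] is bounded too, since it could otherwise drive [v'] out of its bounds. Extracting a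
   convergent subsequence of the Cauchy data at one point, Gronwall's inequality upgrades this to
   locally uniform convergence to a global solution. *)
Require Import Defs.
From Stdlib Require Import Reals Lra Lia IndefiniteDescription.
From Coquelicot Require Import Coquelicot.
Open Scope R_scope.

(** The exponent in [f = exp (R v)] is chosen so that [f^(1 - 1/R) = f exp (-v)]: division by
    [R b^2 f / 2] then removes [f] altogether. The right-hand side increases with [v], which is the
    monotonicity that a maximum principle wants. Well-posedness enters through the level [M]:
    [exp (-M) = C / 2] lies strictly below [eta] with the same [C] on all of [E], so [M] survives
    the exhaustion. From below there is no such uniform level, because [eta] may be unbounded near
    the ends of [E]; the level [m] of the compact problem depends on the interval, and the local
    estimates must supply a lower bound of their own. The quadratic term has one sign, so it stops
    [v'] from rising as [t] increases and from falling as [t] decreases. Each of these one-sided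
    controls needs a good starting slope, which is why both boundary values sit at the top level
    [M]. A solution is determined by [(v, v')] at one point, so a subsequence chosen there serves
    every compact subinterval. *)

(** * One-variable calculus: local comparison, extrema and barriers *)

Lemma is_derive_continuity_pt f x l : is_derive f x l -> continuity_pt f x.
Proof.
  intros H. apply continuity_pt_filterlim.
  apply (ex_derive_continuous f x). now exists l.
Qed.

Lemma mean_value f df a b :
  a <= b -> (forall t, a <= t <= b -> is_derive f t (df t)) ->
  exists c, a <= c <= b /\ f b - f a = df c * (b - a).
Proof.
  intros Hab Hd.
  destruct (MVT_gen f a b df) as [c Hc];
    rewrite ?(Rmin_left a b Hab), ?(Rmax_right a b Hab) in *.
  - intros x Hx. apply Hd. lra.
  - intros x Hx. apply (is_derive_continuity_pt f x (df x)). apply Hd. lra.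
  - now exists c.
Qed.

Lemma derive_nonneg_le f df a b :
  a <= b -> (forall t, a <= t <= b -> is_derive f t (df t)) ->
  (forall t, a <= t <= b -> 0 <= df t) -> f a <= f b.
Proof.
  intros Hab Hd Hp. destruct (mean_value f df a b Hab Hd) as [c [Hc E]].
  specialize (Hp c Hc). nra.
Qed.

(** Only the derivative at the point itself is known, so values are compared with [f x] alone and no
    monotonicity near [x] is claimed. *)
Lemma derive_pos_locally f x l :
  is_derive f x l -> 0 < l ->
  exists e, 0 < e /\
    (forall y, x < y < x + e -> f x < f y) /\
    (forall y, x - e < y < x -> f y < f x).
Proof.
  intros H Hl. apply is_derive_Reals in H.
  destruct (H (l / 2) ltac:(lra)) as [e He]. exists e.
  assert (K : forall k, k <> 0 -> Rabs k < e -> 0 < (f (x + k) - f x) / k).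
  { intros k Hk Hke. specialize (He k Hk Hke). apply Rabs_def2 in He. lra. }
  split; [apply cond_pos|split].
  - intros y Hy. specialize (K (y - x) ltac:(lra)).
    replace (x + (y - x)) with y in K by ring.
    assert (K' : 0 < (f y - f x) / (y - x)) by (apply K; rewrite Rabs_right; lra).
    assert (0 < (f y - f x) / (y - x) * (y - x)) by (apply Rmult_lt_0_compat; lra).
    replace ((f y - f x) / (y - x) * (y - x)) with (f y - f x) in H0 by (field; lra). lra.
  - intros y Hy. specialize (K (y - x) ltac:(lra)).
    replace (x + (y - x)) with y in K by ring.
    assert (K' : 0 < (f y - f x) / (y - x)) by (apply K; rewrite Rabs_left; lra).
    assert (0 < (f y - f x) / (y - x) * (x - y)) by (apply Rmult_lt_0_compat; lra).
    replace ((f y - f x) / (y - x) * (x - y)) with (- (f y - f x)) in H0 by (field; lra). lra.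
Qed.

Lemma derive_neg_locally f x l :
  is_derive f x l -> l < 0 ->
  exists e, 0 < e /\
    (forall y, x < y < x + e -> f y < f x) /\
    (forall y, x - e < y < x -> f x < f y).
Proof.
  intros H Hl.
  destruct (derive_pos_locally (fun t => - f t) x (- l)) as [e [He [H1 H2]]].
  - apply (is_derive_opp f x l H).
  - lra.
  - exists e. split; [exact He|split]; intros y Hy;
      [specialize (H1 y Hy)|specialize (H2 y Hy)]; lra.
Qed.

Lemma interior_max f g k a b x :
  a < x < b ->
  (forall t, a <= t <= b -> is_derive f t (g t)) -> is_derive g x k ->
  (forall t, a <= t <= b -> f t <= f x) -> g x = 0 /\ k <= 0.
Proof.
  intros Hx Hf Hg Hm.
  assert (G0 : g x = 0).
  { destruct (Rtotal_order (g x) 0) as [Hn|[E|Hp]]; [|exact E|].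
    - destruct (derive_neg_locally f x (g x)) as [e [He [_ H]]];
        [apply Hf; lra|exact Hn|].
      assert (Hy : x - e < Rmax a (x - e / 2) < x).
      { unfold Rmax; destruct Rle_dec; lra. }
      specialize (H _ Hy). specialize (Hm (Rmax a (x - e / 2))).
      assert (a <= Rmax a (x - e / 2)) by apply Rmax_l. lra.
    - destruct (derive_pos_locally f x (g x)) as [e [He [H _]]];
        [apply Hf; lra|exact Hp|].
      assert (Hy : x < Rmin b (x + e / 2) < x + e).
      { unfold Rmin; destruct Rle_dec; lra. }
      specialize (H _ Hy). specialize (Hm (Rmin b (x + e / 2))).
      assert (Rmin b (x + e / 2) <= b) by apply Rmin_l. lra. }
  split; [exact G0|]. apply Rnot_lt_le. intros Hk.
  destruct (derive_pos_locally g x k Hg Hk) as [e [He [H _]]].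
  set (y := Rmin b (x + e / 2)).
  assert (Hy : x < y < x + e) by (unfold y, Rmin; destruct Rle_dec; lra).
  assert (Hyb : y <= b) by apply Rmin_l.
  (* [mean_value] may return an endpoint, and [g] vanishes at [x]. Starting at the midpoint keeps
     the intermediate point away from [x], so the increase from [z] to [y] is strict. *)
  set (z := (x + y) / 2).
  assert (f x <= f z).
  { apply (derive_nonneg_le f g); [unfold z; lra| |].
    - intros t Ht. apply Hf. unfold z in Ht. lra.
    - intros t Ht. unfold z in Ht. destruct (Req_dec t x) as [->|Hne]; [lra|].
      assert (g x < g t) by (apply H; lra). lra. }
  destruct (mean_value f g z y) as [c [Hc E]]; [unfold z; lra| |].
  { intros t Ht. apply Hf. unfold z in Ht. lra. }
  assert (0 < g c) by (rewrite <- G0; apply H; unfold z in Hc; lra).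
  assert (0 < g c * (y - z)) by (apply Rmult_lt_0_compat; unfold z; lra).
  specialize (Hm y ltac:(lra)). lra.
Qed.

(** If [f] exceeded [N], its maximum over [[a, t]] would lie at some [m > a] with [df m < 0], and
    values just to the left of [m] would be larger still. *)
Lemma barrier_forward f df a b N :
  (forall t, a <= t <= b -> is_derive f t (df t)) -> f a <= N ->
  (forall t, a < t <= b -> N < f t -> df t < 0) ->
  forall t, a <= t <= b -> f t <= N.
Proof.
  intros Hd Ha Hb t Ht. apply Rnot_lt_le. intros Hlt.
  destruct (continuity_ab_maj f a t) as [m [Hm Hmt]]; [lra| |].
  { intros c Hc. apply (is_derive_continuity_pt f c (df c)). apply Hd. lra. }
  assert (Hfm : N < f m) by (specialize (Hm t ltac:(lra)); lra).
  assert (a < m) by (destruct (Req_dec m a) as [->|]; lra).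
  destruct (derive_neg_locally f m (df m)) as [e [He [_ H']]].
  - apply Hd. lra.
  - apply Hb; lra.
  - assert (Hy : m - e < Rmax a (m - e / 2) < m).
    { unfold Rmax; destruct Rle_dec; lra. }
    specialize (H' _ Hy). specialize (Hm (Rmax a (m - e / 2))).
    assert (a <= Rmax a (m - e / 2)) by apply Rmax_l. lra.
Qed.

Lemma is_derive_reflect f x l :
  is_derive f (- x) l -> is_derive (fun t => f (- t)) x (- l).
Proof.
  intros H. replace (- l) with (scal (-1) l) by (unfold scal; simpl; unfold mult; simpl; ring).
  apply (is_derive_comp f Ropp x l (-1)); [exact H|].
  auto_derive; [exact I|ring].
Qed.

Lemma barrier_backward f df a b N :
  (forall t, a <= t <= b -> is_derive f t (df t)) -> f b <= N ->
  (forall t, a <= t < b -> N < f t -> 0 < df t) ->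
  forall t, a <= t <= b -> f t <= N.
Proof.
  intros Hd Hb Hp t Ht.
  rewrite <- (Ropp_involutive t).
  apply (barrier_forward (fun s => f (- s)) (fun s => - df (- s)) (- b) (- a) N).
  - intros s Hs. apply is_derive_reflect, Hd. lra.
  - now rewrite Ropp_involutive.
  - intros s Hs Hl. assert (0 < df (- s)) by (apply Hp; lra). lra.
  - lra.
Qed.

(** * Gronwall estimates in both time directions *)

(** The bound on [Rabs (dE t)] makes [E t exp (- c t)] nonincreasing and [E t exp (c t)]
    nondecreasing; the first treats [x <= y], the second [y < x]. *)
Lemma gronwall E dE a b c :
  (forall t, a <= t <= b -> is_derive E t (dE t)) ->
  (forall t, a <= t <= b -> Rabs (dE t) <= c * E t) ->
  forall x y, a <= x <= b -> a <= y <= b -> E y <= E x * exp (c * Rabs (y - x)).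
Proof.
  intros Hd Hb x y Hx Hy.
  assert (Hs : forall k t, a <= t <= b ->
    is_derive (fun s => E s * exp (k * s)) t ((dE t + k * E t) * exp (k * t))).
  { intros k t Ht. specialize (Hd t Ht).
    assert (He : is_derive (fun s => exp (k * s)) t (k * exp (k * t)))
      by (auto_derive; [exact I|ring]).
    replace ((dE t + k * E t) * exp (k * t))
      with (dE t * exp (k * t) + E t * (k * exp (k * t))) by ring.
    apply (is_derive_mult E (fun s => exp (k * s)) t _ _ Hd He).
    intros; apply Rmult_comm. }
  assert (Hm : forall u v k, u * exp (k * y) <= v * exp (k * x) ->
     u <= v * exp (k * x - k * y)).
  { intros u v k H. unfold Rminus. rewrite exp_plus, exp_Ropp.
    assert (P := exp_pos (k * y)).
    apply Rmult_le_reg_r with (exp (k * y)); [exact P|].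
    replace (v * (exp (k * x) * / exp (k * y)) * exp (k * y))
      with (v * exp (k * x)) by (field; lra). exact H. }
  destruct (Rle_dec x y) as [Hxy|Hxy].
  - rewrite Rabs_right by lra.
    replace (c * (y - x)) with (- c * x - - c * y) by ring. apply Hm.
    apply Ropp_le_cancel.
    apply (derive_nonneg_le (fun s => - (E s * exp (- c * s)))
      (fun s => - ((dE s + - c * E s) * exp (- c * s))) x y Hxy).
    + intros t Ht. apply (is_derive_opp (fun s => E s * exp (- c * s))). apply Hs. lra.
    + intros t Ht. assert (P := exp_pos (- c * t)).
      specialize (Hb t ltac:(lra)). assert (Q := Rle_abs (dE t)). nra.
  - rewrite Rabs_left by lra.
    replace (c * - (y - x)) with (c * x - c * y) by ring. apply Hm.
    apply (derive_nonneg_le (fun s => E s * exp (c * s))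
      (fun s => (dE s + c * E s) * exp (c * s)) y x ltac:(lra)).
    + intros t Ht. apply Hs. lra.
    + intros t Ht. assert (P := exp_pos (c * t)).
      specialize (Hb t ltac:(lra)). assert (Q := Rle_abs (- dE t)).
      rewrite Rabs_Ropp in Q. nra.
Qed.

(** Squares keep the distance differentiable. With [p], [q], [r] the differences of the [v], [w],
    [h], its derivative is [2 p q + 2 q r]. The first term is at most [p^2 + q^2], the second at
    most [2 L (|p| |q| + q^2) <= 3 L (p^2 + q^2)]; hence the rate [1 + 3 L]. *)
Lemma gronwall_pair v1 w1 h1 v2 w2 h2 a b L :
  0 <= L ->
  (forall t, a <= t <= b -> is_derive v1 t (w1 t) /\ is_derive w1 t (h1 t)) ->
  (forall t, a <= t <= b -> is_derive v2 t (w2 t) /\ is_derive w2 t (h2 t)) ->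
  (forall t, a <= t <= b ->
    Rabs (h1 t - h2 t) <= L * (Rabs (v1 t - v2 t) + Rabs (w1 t - w2 t))) ->
  forall x y, a <= x <= b -> a <= y <= b ->
  (v1 y - v2 y) ^ 2 + (w1 y - w2 y) ^ 2 <=
  ((v1 x - v2 x) ^ 2 + (w1 x - w2 x) ^ 2) * exp ((1 + 3 * L) * Rabs (y - x)).
Proof.
  intros HL H1 H2 Hl.
  apply (gronwall (fun t => (v1 t - v2 t) ^ 2 + (w1 t - w2 t) ^ 2)
    (fun t => 2 * (v1 t - v2 t) * (w1 t - w2 t) + 2 * (w1 t - w2 t) * (h1 t - h2 t))).
  - intros t Ht. destruct (H1 t Ht) as [A1 B1], (H2 t Ht) as [A2 B2].
    auto_derive.
    + repeat split; eexists; eassumption.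
    + replace (Derive (fun x => v1 x) t) with (w1 t) by (symmetry; apply is_derive_unique, A1).
      replace (Derive (fun x => v2 x) t) with (w2 t) by (symmetry; apply is_derive_unique, A2).
      replace (Derive (fun x => w1 x) t) with (h1 t) by (symmetry; apply is_derive_unique, B1).
      replace (Derive (fun x => w2 x) t) with (h2 t) by (symmetry; apply is_derive_unique, B2).
      ring.
  - intros t Ht. specialize (Hl t Ht).
    set (p := v1 t - v2 t) in *. set (q := w1 t - w2 t) in *. set (r := h1 t - h2 t) in *.
    replace (p ^ 2) with (Rabs p ^ 2) by apply pow2_abs.
    replace (q ^ 2) with (Rabs q ^ 2) by apply pow2_abs.
    eapply Rle_trans; [apply Rabs_triang|]. rewrite !Rabs_mult, (Rabs_right 2) by lra.
    assert (Pp := Rabs_pos p). assert (Pq := Rabs_pos q).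
    assert (Rabs q * Rabs r <= Rabs q * (L * (Rabs p + Rabs q)))
      by (apply Rmult_le_compat_l; assumption).
    assert (2 * (Rabs p * Rabs q) <= Rabs p ^ 2 + Rabs q ^ 2)
      by (assert (0 <= (Rabs p - Rabs q) ^ 2) by apply pow2_ge_0; lra).
    assert (0 <= L * Rabs q ^ 2) by (apply Rmult_le_pos; [lra|apply pow2_ge_0]).
    assert (0 <= L * Rabs p ^ 2) by (apply Rmult_le_pos; [lra|apply pow2_ge_0]).
    assert (L * (2 * (Rabs p * Rabs q)) <= L * (Rabs p ^ 2 + Rabs q ^ 2))
      by (apply Rmult_le_compat_l; lra).
    nra.
Qed.

(** * Uniform convergence on discs *)

(** The limit is written with the total [Lim_seq], so it does not depend on the disc: the same
    function serves all discs at once. *)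
Lemma CVU_of_cauchy (u : nat -> R -> R) c d :
  (forall eps, 0 < eps -> exists N, forall p q t, (N <= p)%nat -> (N <= q)%nat ->
     Boule c d t -> Rabs (u p t - u q t) <= eps) ->
  CVU u (fun t => real (Lim_seq (fun n => u n t))) c d.
Proof.
  intros H eps Heps. destruct (H (eps / 2) ltac:(lra)) as [N HN].
  exists N. intros n t Hn Ht.
  assert (Hf : ex_finite_lim_seq (fun n => u n t)).
  { apply ex_lim_seq_cauchy_corr. intros e.
    destruct (H (e / 2)) as [N' HN']; [destruct e; simpl; lra|].
    exists N'. intros p q Hp Hq. specialize (HN' p q t Hp Hq Ht).
    destruct e; simpl in *; lra. }
  apply Lim_seq_correct' in Hf.
  set (l := real (Lim_seq (fun n => u n t))) in *.
  apply Rle_lt_trans with (eps / 2); [|lra].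
  assert (Hl : is_lim_seq (fun k => Rabs (u k t - u n t)) (Rabs (l - u n t))).
  { apply (is_lim_seq_abs _ (l - u n t)). apply (is_lim_seq_minus' (fun k => u k t) (fun _ => u n t) l (u n t));
      [exact Hf|apply is_lim_seq_const]. }
  apply (is_lim_seq_le_loc (fun k => Rabs (u k t - u n t)) (fun _ => eps / 2)
    (Rabs (l - u n t)) (eps / 2)); [|exact Hl|apply is_lim_seq_const].
  exists N. intros k Hk. apply HN; assumption.
Qed.

Lemma CVU_Un_cv u g c d t : CVU u g c d -> Boule c d t -> Un_cv (fun n => u n t) (g t).
Proof.
  intros H Ht e He. destruct (H e He) as [N HN]. exists N. intros n Hn.
  unfold Rdist. rewrite Rabs_minus_sym. now apply HN.
Qed.

Lemma CVU_shift u g c d k : CVU u g c d -> CVU (fun n => u (n + k)%nat) g c d.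
Proof.
  intros H e He. destruct (H e He) as [N HN]. exists N. intros n y Hn Hy.
  apply HN; [lia|exact Hy].
Qed.

Lemma CVU_lipschitz (u v h : nat -> R -> R) u' v' h' c d L :
  0 <= L -> CVU u u' c d -> CVU v v' c d ->
  (forall n t, Boule c d t ->
    Rabs (h n t - h' t) <= L * (Rabs (u n t - u' t) + Rabs (v n t - v' t))) ->
  CVU h h' c d.
Proof.
  intros HL Hu Hv Hh e He.
  assert (Hk : 0 < e / (2 * (L + 1))) by (apply Rdiv_lt_0_compat; lra).
  destruct (Hu _ Hk) as [N1 H1], (Hv _ Hk) as [N2 H2].
  exists (N1 + N2)%nat. intros n y Hn Hy.
  specialize (H1 n y ltac:(lia) Hy). specialize (H2 n y ltac:(lia) Hy).
  specialize (Hh n y Hy). rewrite Rabs_minus_sym in H1, H2. rewrite Rabs_minus_sym.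
  set (p := e / (2 * (L + 1))) in *.
  assert (e = 2 * (L + 1) * p) by (unfold p; field; lra).
  apply Rle_lt_trans with (L * (p + p)); [|nra].
  eapply Rle_trans; [exact Hh|]. apply Rmult_le_compat_l; lra.
Qed.

(** * Global Picard iteration for bounded Lipschitz right-hand sides *)

Lemma is_derive_primitive (f : R -> R) a c t :
  (forall x, continuous f x) -> is_derive (fun x => c + RInt f a x) t (f t).
Proof.
  intros Hf.
  assert (H : is_derive (RInt f a) t (f t)).
  { apply is_derive_RInt with a; [|apply Hf].
    exists (mkposreal 1 Rlt_0_1). intros y _.
    apply (RInt_correct (V := R_CompleteNormedModule)), ex_RInt_continuous. intros; apply Hf. }
  replace (f t) with (plus (0 : R) (f t)) by (unfold plus; simpl; ring).
  apply (is_derive_plus (fun _ => c) (RInt f a) t); [|exact H].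
  apply (is_derive_const (K := R_AbsRing) (V := R_NormedModule)).
Qed.

(** Integration from [a] gains a factor [1 / lam] against the weight [exp (lam |t - a|)]. With this
    Bielecki weight the Picard iteration contracts on the whole line, and no local solutions have to
    be glued. *)
Lemma exp_growth_upper (u du : R -> R) D lam a :
  0 < lam -> u a = 0 -> (forall t, is_derive u t (du t)) ->
  (forall t, Rabs (du t) <= D * exp (lam * Rabs (t - a))) ->
  forall t, u t <= D / lam * exp (lam * Rabs (t - a)).
Proof.
  intros Hlam H0 Hd Hb t.
  assert (HD : 0 <= D).
  { specialize (Hb a). rewrite Rminus_eq_0, Rabs_R0, Rmult_0_r, exp_0 in Hb.
    assert (P := Rabs_pos (du a)). lra. }
  assert (HD' : 0 <= D / lam) by (apply Rdiv_le_0_compat; lra).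
  assert (Hg : forall k s, is_derive (fun s => D / lam * exp (k * (s - a)) - u s) s
     (D / lam * (k * exp (k * (s - a))) - du s)).
  { intros k s. apply (is_derive_minus (fun s => D / lam * exp (k * (s - a))) u); [|apply Hd].
    auto_derive; [exact I|unfold Rminus; ring]. }
  destruct (Rle_dec a t) as [Hat|Hat].
  - rewrite Rabs_right by lra.
    assert (D / lam * exp (lam * (a - a)) - u a <= D / lam * exp (lam * (t - a)) - u t).
    { apply (derive_nonneg_le _ _ a t Hat (fun s _ => Hg lam s)). intros s Hs.
      specialize (Hb s). rewrite (Rabs_right (s - a)) in Hb by lra.
      assert (P := Rle_abs (du s)).
      replace (D / lam * (lam * exp (lam * (s - a)))) with (D * exp (lam * (s - a)))
        by (field; lra). lra. }
    rewrite Rminus_eq_0, Rmult_0_r, exp_0, H0 in H. lra.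
  - rewrite Rabs_left by lra.
    assert (- (D / lam * exp (- lam * (t - a)) - u t) <= - (D / lam * exp (- lam * (a - a)) - u a)).
    { apply (derive_nonneg_le (fun s => - (D / lam * exp (- lam * (s - a)) - u s))
        (fun s => - (D / lam * (- lam * exp (- lam * (s - a))) - du s))); [lra| |].
      - intros s _. apply (is_derive_opp (fun s => D / lam * exp (- lam * (s - a)) - u s)), Hg.
      - intros s Hs. specialize (Hb s).
        rewrite (Rabs_minus_sym s a), (Rabs_right (a - s)) in Hb by lra.
        assert (P := Rle_abs (- du s)). rewrite Rabs_Ropp in P.
        replace (D / lam * (- lam * exp (- lam * (s - a)))) with (- (D * exp (lam * (a - s)))).
        lra.
        replace (- lam * (s - a)) with (lam * (a - s)) by ring. field; lra. }
    rewrite Rminus_eq_0, Rmult_0_r, exp_0, H0 in H.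
    replace (lam * - (t - a)) with (- lam * (t - a)) by ring. lra.
Qed.

Lemma exp_growth (u du : R -> R) D lam a :
  0 < lam -> u a = 0 -> (forall t, is_derive u t (du t)) ->
  (forall t, Rabs (du t) <= D * exp (lam * Rabs (t - a))) ->
  forall t, Rabs (u t) <= D / lam * exp (lam * Rabs (t - a)).
Proof.
  intros Hlam H0 Hd Hb t. apply Rabs_le. split.
  - assert (- u t <= D / lam * exp (lam * Rabs (t - a))); [|lra].
    apply (exp_growth_upper (fun s => - u s) (fun s => - du s)); [exact Hlam|lra| |].
    + intros s. apply (is_derive_opp u), Hd.
    + intros s. rewrite Rabs_Ropp. apply Hb.
  - now apply (exp_growth_upper u du).
Qed.

Lemma geometric_cauchy (u : nat -> R) C :
  (forall n, Rabs (u (S n) - u n) <= C * (/ 2) ^ n) ->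
  forall n p q, (n <= p)%nat -> (n <= q)%nat -> Rabs (u p - u q) <= 4 * C * (/ 2) ^ n.
Proof.
  intros H.
  (* Keeping the subtracted tail of the geometric sum is what lets the induction on [k] close. *)
  assert (K : forall n k, Rabs (u (n + k)%nat - u n) <= 2 * C * ((/ 2) ^ n - (/ 2) ^ (n + k))).
  { intros n k. induction k as [|k IH].
    - rewrite Nat.add_0_r, Rminus_eq_0, Rabs_R0. lra.
    - rewrite Nat.add_succ_r. specialize (H (n + k)%nat).
      replace (u (S (n + k)) - u n) with ((u (S (n + k)) - u (n + k)%nat) + (u (n + k)%nat - u n)) by ring.
      eapply Rle_trans; [apply Rabs_triang|]. simpl pow. lra. }
  assert (HC : 0 <= C).
  { specialize (H O). simpl in H. assert (P := Rabs_pos (u 1%nat - u O)). lra. }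
  assert (K' : forall n p, (n <= p)%nat -> Rabs (u p - u n) <= 2 * C * (/ 2) ^ n).
  { intros n p Hp. replace p with (n + (p - n))%nat by lia.
    eapply Rle_trans; [apply K|].
    assert (0 <= (/ 2) ^ (n + (p - n))) by (apply pow_le; lra). nra. }
  intros n p q Hp Hq. specialize (K' n).
  replace (u p - u q) with ((u p - u n) + - (u q - u n)) by ring.
  eapply Rle_trans; [apply Rabs_triang|]. rewrite Rabs_Ropp.
  assert (A := K' p Hp). assert (B := K' q Hq). lra.
Qed.

Lemma geometric_CVU (u : nat -> R -> R) C lam a d :
  0 <= lam ->
  (forall n t, Rabs (u (S n) t - u n t) <= C * (/ 2) ^ n * exp (lam * Rabs (t - a))) ->
  CVU u (fun t => real (Lim_seq (fun n => u n t))) a d.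
Proof.
  intros Hlam H. apply CVU_of_cauchy. intros e He.
  set (K := 4 * Rabs C * exp (lam * d)).
  assert (HK : 0 <= K).
  { unfold K. assert (P := Rabs_pos C). assert (Q := exp_pos (lam * d)). nra. }
  destruct (pow_lt_1_zero (/ 2)) with (y := e / (K + 1)) as [N HN].
  { rewrite Rabs_right; lra. }
  { apply Rdiv_lt_0_compat; lra. }
  exists N. intros p q t Hp Hq Ht.
  apply Rle_trans with (K * (/ 2) ^ N).
  - unfold K. replace (4 * Rabs C * exp (lam * d)) with (4 * (Rabs C * exp (lam * d))) by ring.
    apply (geometric_cauchy (fun n => u n t)); [|exact Hp|exact Hq].
    intros n. eapply Rle_trans; [apply H|].
    assert (P : 0 <= (/ 2) ^ n) by (apply pow_le; lra).
    apply Rle_trans with (Rabs C * (/ 2) ^ n * exp (lam * Rabs (t - a))).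
    + apply Rmult_le_compat_r; [left; apply exp_pos|].
      apply Rmult_le_compat_r; [exact P|apply Rle_abs].
    + replace (Rabs C * exp (lam * d) * (/ 2) ^ n) with (Rabs C * (/ 2) ^ n * exp (lam * d)) by ring.
      apply Rmult_le_compat_l; [apply Rmult_le_pos; [apply Rabs_pos|exact P]|].
      assert (lam * Rabs (t - a) <= lam * d).
      { apply Rmult_le_compat_l; [exact Hlam|]. unfold Boule in Ht. lra. }
      destruct H0 as [H0| ->]; [left; now apply exp_increasing|right; reflexivity].
  - specialize (HN N (le_n N)). rewrite Rabs_right in HN by (apply Rle_ge, pow_le; lra).
    assert (e = (K + 1) * (e / (K + 1))) by (field; lra).
    set (z := e / (K + 1)) in *. nra.
Qed.

(** Only the derivative is iterated; the position is recovered as its primitive, so the relation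
    [v' = w] holds exactly at every stage. *)
Fixpoint picard (G : R -> R -> R -> R) a v0 s (n : nat) : R -> R :=
  match n with
  | O => fun _ => s
  | S n => let w := picard G a v0 s n in
           fun t => s + RInt (fun x => G x (v0 + RInt w a x) (w x)) a t
  end.

(** The Lipschitz bound yields the contraction, and [Gmax] bounds the first increment. Continuity of
    [G] is asked along continuous curves, the form in which the integrands of the iteration need
    it. *)
Theorem picard_lindelof G L Gmax a v0 s :
  0 <= L ->
  (forall t v w v' w', Rabs (G t v w - G t v' w') <= L * (Rabs (v - v') + Rabs (w - w'))) ->
  (forall t v w, Rabs (G t v w) <= Gmax) ->
  (forall v w : R -> R, (forall t, continuous v t) -> (forall t, continuous w t) ->
     forall t, continuous (fun x => G x (v x) (w x)) t) ->
  exists v w : R -> R, v a = v0 /\ w a = s /\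
    forall t, is_derive v t (w t) /\ is_derive w t (G t (v t) (w t)).
Proof.
  intros HL Hlip Hmax Hcont.
  set (W := picard G a v0 s).
  set (V := fun n t => v0 + RInt (W n) a t).
  set (H := fun n t => G t (V n t) (W n t)).
  assert (Hc : forall n, (forall t, continuous (W n) t) /\ (forall t, continuous (H n) t)).
  { assert (A : forall n, (forall t, continuous (W n) t) -> forall t, continuous (H n) t).
    { intros n HW. apply Hcont; [|exact HW]. intros t.
      apply (ex_derive_continuous (V n) t). exists (W n t). now apply is_derive_primitive. }
    induction n as [|n [IHw IHh]].
    - assert (forall t, continuous (W O) t) by (intros t; apply continuous_const).
      split; [assumption|]. now apply A.
    - assert (forall t, continuous (W (S n)) t).
      { intros t. apply (ex_derive_continuous (W (S n)) t). exists (H n t).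
        apply (is_derive_primitive (H n) a s t IHh). }
      split; [assumption|]. now apply A. }
  assert (dV : forall n t, is_derive (V n) t (W n t)).
  { intros n t. apply is_derive_primitive. apply Hc. }
  assert (dW : forall n t, is_derive (W (S n)) t (H n t)).
  { intros n t. apply (is_derive_primitive (H n) a s t). apply Hc. }
  assert (Va : forall n, V n a = v0).
  { intros n. unfold V. rewrite RInt_point. unfold zero; simpl. ring. }
  assert (Wa : forall n, W n a = s).
  { intros [|n]; [reflexivity|]. change (s + RInt (H n) a a = s).
    rewrite RInt_point. unfold zero; simpl. ring. }
  (* This gives [2 L / lam <= 1 / 2], the contraction factor of one step; also [lam >= 1], so
     passing from [W] to its primitive [V] does not worsen the estimate. *)
  set (lam := 4 * L + 1).
  assert (Hlam : 1 <= lam) by (unfold lam; lra).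
  set (C := Gmax).
  assert (HC : 0 <= C).
  { unfold C. assert (P := Rabs_pos (G 0 0 0)). specialize (Hmax 0 0 0). lra. }
  assert (EV : forall n D, 0 <= D ->
    (forall t, Rabs (W (S n) t - W n t) <= D * exp (lam * Rabs (t - a))) ->
    forall t, Rabs (V (S n) t - V n t) <= D * exp (lam * Rabs (t - a))).
  { intros n D HD HW t.
    eapply Rle_trans.
    - apply (exp_growth (fun t => V (S n) t - V n t) (fun t => W (S n) t - W n t) D lam a).
      + lra.
      + rewrite !Va. ring.
      + intros x. apply (is_derive_minus (V (S n)) (V n)); apply dV.
      + exact HW.
    - apply Rmult_le_compat_r; [left; apply exp_pos|].
      apply Rle_div_l; [lra|]. nra. }
  assert (EW : forall n t, Rabs (W (S n) t - W n t) <= C * (/ 2) ^ n * exp (lam * Rabs (t - a))).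
  { induction n as [|n IH]; intros t.
    - eapply Rle_trans.
      + apply (exp_growth (fun t => W 1%nat t - W O t) (fun t => H O t) C lam a).
        * lra.
        * rewrite !Wa. ring.
        * intros x. replace (H O x) with (H O x - 0) by ring.
          apply (is_derive_minus (W 1%nat) (W O)); [apply dW|apply (is_derive_const (K := R_AbsRing) (V := R_NormedModule))].
        * intros x. apply Rle_trans with (C * 1).
          -- rewrite Rmult_1_r. apply Hmax.
          -- apply Rmult_le_compat_l; [exact HC|]. rewrite <- exp_0.
             assert (0 <= lam * Rabs (x - a))
               by (apply Rmult_le_pos; [lra|apply Rabs_pos]).
             destruct H0 as [H0| <-]; [left; now apply exp_increasing|right; reflexivity].
      + simpl. apply Rmult_le_compat_r; [left; apply exp_pos|].
        apply Rle_div_l; [lra|]. nra.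
    - assert (Hp : 0 <= (/ 2) ^ n) by (apply pow_le; lra).
      assert (HD : 0 <= C * (/ 2) ^ n) by nra.
      assert (IV := EV n _ HD IH).
      eapply Rle_trans.
      + apply (exp_growth (fun t => W (S (S n)) t - W (S n) t) (fun t => H (S n) t - H n t)
          (2 * L * (C * (/ 2) ^ n)) lam a).
        * lra.
        * rewrite !Wa. ring.
        * intros x. apply (is_derive_minus (W (S (S n))) (W (S n))); apply dW.
        * intros x. eapply Rle_trans; [apply Hlip|].
          specialize (IV x). specialize (IH x).
          replace (2 * L * (C * (/ 2) ^ n) * exp (lam * Rabs (x - a))) with
            (L * (C * (/ 2) ^ n * exp (lam * Rabs (x - a)) + C * (/ 2) ^ n * exp (lam * Rabs (x - a))))
            by ring.
          apply Rmult_le_compat_l; lra.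
      + apply Rmult_le_compat_r; [left; apply exp_pos|].
        apply Rle_div_l; [lra|]. simpl pow. unfold lam. nra. }
  assert (EV' : forall n t, Rabs (V (S n) t - V n t) <= C * (/ 2) ^ n * exp (lam * Rabs (t - a))).
  { intros n. apply EV; [|apply EW]. assert (0 <= (/ 2) ^ n) by (apply pow_le; lra). nra. }
  set (v := fun t => real (Lim_seq (fun n => V n t))).
  set (w := fun t => real (Lim_seq (fun n => W n t))).
  assert (CV : forall d, CVU V v a d) by (intros d; apply (geometric_CVU V C lam a d); [lra|exact EV']).
  assert (CW : forall d, CVU W w a d) by (intros d; apply (geometric_CVU W C lam a d); [lra|exact EW]).
  exists v, w. split; [|split].
  - unfold v. rewrite (Lim_seq_ext _ (fun _ => v0)) by (intros; apply Va). now rewrite Lim_seq_const.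
  - unfold w. rewrite (Lim_seq_ext _ (fun _ => s)) by (intros; apply Wa). now rewrite Lim_seq_const.
  - intros t.
    assert (Hd : 0 < Rabs (t - a) + 1) by (assert (P := Rabs_pos (t - a)); lra).
    set (d := mkposreal _ Hd).
    assert (Ht : Boule a d t) by (unfold Boule; simpl; lra).
    split; apply is_derive_Reals.
    + apply (CVU_derivable V W v w a d (CW d)); [| |exact Ht].
      * intros x Hx. now apply (CVU_Un_cv V v a d).
      * intros n x _. apply is_derive_Reals, dV.
    (* The index is shifted because [H n] is the derivative of [W (S n)], not of [W n]. *)
    + apply (CVU_derivable (fun n => W (n + 1)%nat) H w (fun t => G t (v t) (w t)) a d); [| | |exact Ht].
      * apply (CVU_lipschitz V W H v w (fun t => G t (v t) (w t)) a d L HL (CV d) (CW d)).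
        intros n x _. apply Hlip.
      * intros x Hx. apply (CVU_Un_cv (fun n => W (n + 1)%nat) w a d); [|exact Hx].
        apply CVU_shift, CW.
      * intros n x _. apply is_derive_Reals. rewrite Nat.add_1_r. apply dW.
Qed.

(** * Clamping and Lipschitz bounds *)

Definition clamp (a b x : R) : R := Rmax a (Rmin b x).

Lemma clamp_bounds a b x : a <= b -> a <= clamp a b x <= b.
Proof. intros H. unfold clamp, Rmax, Rmin; repeat destruct Rle_dec; lra. Qed.

Lemma clamp_id a b x : a <= x <= b -> clamp a b x = x.
Proof. intros H. unfold clamp, Rmax, Rmin; repeat destruct Rle_dec; lra. Qed.

Lemma clamp_above a b x : a <= b -> b <= x -> clamp a b x = b.
Proof. intros H H'. unfold clamp, Rmax, Rmin; repeat destruct Rle_dec; lra. Qed.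

Lemma clamp_below a b x : a <= b -> x <= a -> clamp a b x = a.
Proof. intros H H'. unfold clamp, Rmax, Rmin; repeat destruct Rle_dec; lra. Qed.

Lemma clamp_lipschitz a b x y : Rabs (clamp a b x - clamp a b y) <= Rabs (x - y).
Proof.
  unfold clamp, Rmax, Rmin, Rabs; repeat destruct Rle_dec; repeat destruct Rcase_abs; lra.
Qed.

Lemma lipschitz_continuous (f : R -> R) L x e :
  0 < e ->
  (forall y, Rabs (y - x) < e -> Rabs (f y - f x) <= L * Rabs (y - x)) -> continuous f x.
Proof.
  intros He H. apply continuity_pt_filterlim, continuity_pt_locally. intros eps.
  assert (HL := Rabs_pos L).
  assert (Hp : 0 < eps / (Rabs L + 1)) by (apply Rdiv_lt_0_compat; [apply cond_pos|lra]).
  assert (Hd : 0 < Rmin e (eps / (Rabs L + 1))) by (apply Rmin_pos; lra).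
  exists (mkposreal _ Hd). intros y Hy. unfold ball in Hy; simpl in Hy.
  change (Rabs (y - x) < Rmin e (eps / (Rabs L + 1))) in Hy.
  assert (H1 := Rmin_l e (eps / (Rabs L + 1))). assert (H2 := Rmin_r e (eps / (Rabs L + 1))).
  specialize (H y ltac:(lra)).
  assert (Hq : L * Rabs (y - x) <= Rabs L * Rabs (y - x)).
  { apply Rmult_le_compat_r; [apply Rabs_pos|apply Rle_abs]. }
  assert (pos eps = (Rabs L + 1) * (eps / (Rabs L + 1))) by (field; lra).
  set (z := eps / (Rabs L + 1)) in *. assert (P := Rabs_pos (y - x)). nra.
Qed.

Lemma continuous_clamp a b x : continuous (clamp a b) x.
Proof.
  apply (lipschitz_continuous _ 1 x 1 Rlt_0_1).
  intros y _. rewrite Rmult_1_l. apply clamp_lipschitz.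
Qed.

Lemma compact_bound f a b :
  a <= b -> (forall t, a <= t <= b -> continuous f t) ->
  exists M, 0 <= M /\ forall t, a <= t <= b -> Rabs (f t) <= M.
Proof.
  intros Hab Hf. destruct (continuity_ab_maj (fun t => Rabs (f t)) a b Hab) as [x [Hx _]].
  - intros c Hc. apply (continuity_pt_comp f Rabs); [|apply Rcontinuity_abs].
    apply continuity_pt_filterlim. now apply Hf.
  - exists (Rabs (f x)). split; [apply Rabs_pos|exact Hx].
Qed.

(** For [x <= y] the difference is [exp (-x) (1 - exp (x - y))], and [1 + z <= exp z] finishes. The
    constant blows up as [m] decreases, so every Lipschitz bound for the equation requires a lower
    bound on [v]. *)
Lemma exp_opp_lipschitz m v v' :
  m <= v -> m <= v' -> Rabs (exp (- v) - exp (- v')) <= exp (- m) * Rabs (v - v').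
Proof.
  assert (K : forall x y, m <= x -> x <= y ->
     Rabs (exp (- x) - exp (- y)) <= exp (- m) * Rabs (x - y)).
  { intros x y Hm Hxy.
    replace (- y) with (- x + (x - y)) by ring. rewrite exp_plus.
    assert (H1 := exp_ineq1_le (x - y)). assert (Px := exp_pos (- x)).
    assert (Pm : exp (- x) <= exp (- m)).
    { destruct Hm as [Hm| ->]; [left; apply exp_increasing; lra|right; reflexivity]. }
    assert (H2 : exp (x - y) <= 1).
    { rewrite <- exp_0. destruct Hxy as [Hxy| ->];
        [left; apply exp_increasing; lra|right; f_equal; ring]. }
    rewrite Rabs_right by nra. rewrite (Rabs_left1 (x - y)) by lra.
    apply Rle_trans with (exp (- x) * (y - x)); [nra|].
    replace (- (x - y)) with (y - x) by ring. apply Rmult_le_compat_r; lra. }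
  intros Hv Hv'. destruct (Rle_dec v v').
  - now apply K.
  - rewrite (Rabs_minus_sym (exp _)), (Rabs_minus_sym v). apply K; lra.
Qed.

(* Logarithmic form of the equation: for [f = exp (R v)] and [p = v'] it reads
   [v'' = riccati k A B e y v p], with [k = R - (R-1) rho^2], [A = 2 atilde / b^2],
   [B = 2 / b^2] and [e = eta]. *)
Definition riccati (k A B e : R -> R) (t v p : R) : R :=
  - k t * p ^ 2 - A t * p + B t * (e t - exp (- v)).

Definition solves (G : R -> R -> R -> R) (a b : R) (v w : R -> R) : Prop :=
  forall t, a <= t <= b -> is_derive v t (w t) /\ is_derive w t (G t (v t) (w t)).

Lemma solves_sub G a b c d v w : a <= c -> d <= b -> solves G a b v w -> solves G c d v w.
Proof. intros Hac Hdb H t Ht. apply H. lra. Qed.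

Lemma riccati_lipschitz k A B e t k1 A1 B1 m K v p v' p' :
  Rabs (k t) <= k1 -> Rabs (A t) <= A1 -> Rabs (B t) <= B1 ->
  m <= v -> m <= v' -> Rabs p <= K -> Rabs p' <= K ->
  Rabs (riccati k A B e t v p - riccati k A B e t v' p') <=
  (2 * k1 * K + A1 + B1 * exp (- m)) * (Rabs (v - v') + Rabs (p - p')).
Proof.
  intros Hk HA HB Hv Hv' Hp Hp'. unfold riccati.
  replace (- k t * p ^ 2 - A t * p + B t * (e t - exp (- v)) -
     (- k t * p' ^ 2 - A t * p' + B t * (e t - exp (- v'))))
    with (- (k t * (p + p') * (p - p')) + - (A t * (p - p')) + - (B t * (exp (- v) - exp (- v'))))
    by ring.
  eapply Rle_trans; [apply Rabs_triang|].
  eapply Rle_trans; [apply Rplus_le_compat_r, Rabs_triang|].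
  rewrite !Rabs_Ropp, !Rabs_mult.
  assert (P := Rabs_pos (p - p')). assert (Q := Rabs_pos (v - v')).
  assert (P1 := Rabs_pos (k t)). assert (P2 := Rabs_pos (A t)). assert (P3 := Rabs_pos (B t)).
  assert (P4 := Rabs_pos (p + p')). assert (Pe := exp_pos (- m)).
  assert (T := Rabs_triang p p').
  assert (HE := exp_opp_lipschitz m v v' Hv Hv').
  assert (PE := Rabs_pos (exp (- v) - exp (- v'))).
  assert (Rabs (k t) * Rabs (p + p') * Rabs (p - p') <= (2 * k1 * K) * Rabs (p - p')).
  { apply Rmult_le_compat_r; [exact P|].
    replace (2 * k1 * K) with (k1 * (2 * K)) by ring. apply Rmult_le_compat; lra. }
  assert (Rabs (A t) * Rabs (p - p') <= A1 * Rabs (p - p')) by (apply Rmult_le_compat_r; lra).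
  assert (Rabs (B t) * Rabs (exp (- v) - exp (- v')) <= B1 * (exp (- m) * Rabs (v - v')))
    by (apply Rmult_le_compat; lra).
  assert (0 <= K) by (assert (X := Rabs_pos p); lra).
  assert (0 <= (2 * k1 * K) * Rabs (v - v')) by (apply Rmult_le_pos; [nra|lra]).
  assert (0 <= A1 * Rabs (v - v')) by (apply Rmult_le_pos; lra).
  assert (0 <= B1 * exp (- m) * Rabs (p - p')) by (apply Rmult_le_pos; [nra|lra]).
  nra.
Qed.

Lemma riccati_bound k A B e t k1 A1 B1 e1 m K v p :
  Rabs (k t) <= k1 -> Rabs (A t) <= A1 -> Rabs (B t) <= B1 -> Rabs (e t) <= e1 ->
  m <= v -> Rabs p <= K ->
  Rabs (riccati k A B e t v p) <= k1 * K ^ 2 + A1 * K + B1 * (e1 + exp (- m)).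
Proof.
  intros Hk HA HB He Hv Hp. unfold riccati.
  eapply Rle_trans; [apply Rabs_triang|].
  assert (E : Rabs (e t - exp (- v)) <= e1 + exp (- m)).
  { eapply Rle_trans; [apply Rabs_triang|]. rewrite Rabs_Ropp.
    apply Rplus_le_compat; [exact He|]. rewrite Rabs_right by (left; apply exp_pos).
    destruct Hv as [Hv| ->]; [left; apply exp_increasing; lra|right; reflexivity]. }
  apply Rplus_le_compat.
  - eapply Rle_trans; [apply Rabs_triang|]. rewrite Rabs_Ropp, !Rabs_mult, Rabs_Ropp.
    rewrite <- RPow_abs.
    apply Rplus_le_compat; apply Rmult_le_compat; try apply Rabs_pos; try assumption.
    + apply pow_le, Rabs_pos.
    + apply pow_incr. split; [apply Rabs_pos|exact Hp].
  - rewrite Rabs_mult. apply Rmult_le_compat; try apply Rabs_pos; assumption.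
Qed.

Lemma continuous_riccati k A B e (g v w : R -> R) t :
  continuous g t -> continuous k (g t) -> continuous A (g t) -> continuous B (g t) ->
  continuous e (g t) -> continuous v t -> continuous w t ->
  continuous (fun x => riccati k A B e (g x) (v x) (w x)) t.
Proof.
  intros Hg Hk HA HB He Hv Hw. unfold riccati.
  assert (C : forall f : R -> R, continuous f (g t) -> continuity_pt (fun x => f (g x)) t).
  { intros f Hf. apply continuity_pt_filterlim. now apply (continuous_comp g f). }
  apply continuity_pt_filterlim in Hv. apply continuity_pt_filterlim in Hw.
  apply continuity_pt_filterlim.
  apply (continuity_pt_plus (fun x => - k (g x) * w x ^ 2 - A (g x) * w x)
    (fun x => B (g x) * (e (g x) - exp (- v x)))).
  - apply (continuity_pt_minus (fun x => - k (g x) * w x ^ 2) (fun x => A (g x) * w x)).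
    + apply (continuity_pt_mult (fun x => - k (g x)) (fun x => w x ^ 2)).
      * apply (continuity_pt_opp (fun x => k (g x))), C, Hk.
      * simpl. apply (continuity_pt_mult w (fun x => w x * 1)); [exact Hw|].
        apply (continuity_pt_mult w (fun x => 1)); [exact Hw|].
        apply continuity_pt_const. intros ? ?; reflexivity.
    + apply (continuity_pt_mult (fun x => A (g x)) w); [apply C, HA|exact Hw].
  - apply (continuity_pt_mult (fun x => B (g x)) (fun x => e (g x) - exp (- v x))); [apply C, HB|].
    apply (continuity_pt_minus (fun x => e (g x)) (fun x => exp (- v x))); [apply C, He|].
    apply (continuity_pt_comp (fun x => - v x) exp); [now apply continuity_pt_opp|].
    apply derivable_continuous_pt, derivable_pt_exp.
Qed.

(** * The Dirichlet problem on a compact interval *)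

Lemma boundary_max_slopes v w a b M :
  a < b -> is_derive v a (w a) -> is_derive v b (w b) -> v a = M -> v b = M ->
  (forall t, a <= t <= b -> v t <= M) -> w a <= 0 <= w b.
Proof.
  intros Hab Ha Hb Va Vb HM. split; apply Rnot_lt_le; intros H.
  - destruct (derive_pos_locally v a (w a) Ha H) as [e [He [K _]]].
    assert (Hy : a < Rmin b (a + e / 2) < a + e) by (unfold Rmin; destruct Rle_dec; lra).
    specialize (K _ Hy). specialize (HM (Rmin b (a + e / 2))).
    assert (Rmin b (a + e / 2) <= b) by apply Rmin_l. lra.
  - destruct (derive_neg_locally v b (w b) Hb H) as [e [He [_ K]]].
    assert (Hy : b - e < Rmax a (b - e / 2) < b) by (unfold Rmax; destruct Rle_dec; lra).
    specialize (K _ Hy). specialize (HM (Rmax a (b - e / 2))).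
    assert (a <= Rmax a (b - e / 2)) by apply Rmax_l. lra.
Qed.

(** With [G] bounded, the slope stays within [Gmax (b - a)] of its initial value, so steep initial
    slopes of either sign over- and undershoot [M]. The end value depends continuously on the
    initial slope by Gronwall, and the intermediate value theorem applies. *)
Lemma shooting G L Gmax a b M :
  a < b -> 0 <= L ->
  (forall t v w v' w', Rabs (G t v w - G t v' w') <= L * (Rabs (v - v') + Rabs (w - w'))) ->
  (forall t v w, Rabs (G t v w) <= Gmax) ->
  (forall v w : R -> R, (forall t, continuous v t) -> (forall t, continuous w t) ->
     forall t, continuous (fun x => G x (v x) (w x)) t) ->
  exists v w, v a = M /\ v b = M /\ solves G a b v w.
Proof.
  intros Hab HL Hlip Hmax Hcont.
  destruct (functional_choice
    (fun s (z : (R -> R) * (R -> R)) => fst z a = M /\ snd z a = s /\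
      forall t, is_derive (fst z) t (snd z t) /\ is_derive (snd z) t (G t (fst z t) (snd z t))))
    as [F HF].
  { intros s. destruct (picard_lindelof G L Gmax a M s HL Hlip Hmax Hcont) as [v [w Hvw]].
    exists (v, w). exact Hvw. }
  set (S := fun s => fst (F s) b).
  assert (HG0 : 0 <= Gmax) by (assert (P := Rabs_pos (G 0 0 0)); specialize (Hmax 0 0 0); lra).
  assert (HS : continuity S).
  { intros s. apply continuity_pt_filterlim.
    set (X := exp ((1 + 3 * L) * Rabs (b - a))).
    apply (lipschitz_continuous S X s 1 Rlt_0_1). intros s' _.
    destruct (HF s) as [A1 [B1 D1]], (HF s') as [A2 [B2 D2]].
    assert (HE := gronwall_pair (fst (F s')) (snd (F s')) (fun t => G t (fst (F s') t) (snd (F s') t))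
      (fst (F s)) (snd (F s)) (fun t => G t (fst (F s) t) (snd (F s) t)) a b L HL
      (fun t _ => D2 t) (fun t _ => D1 t) (fun t _ => Hlip t _ _ _ _) a b ltac:(lra) ltac:(lra)).
    rewrite A1, A2, B1, B2 in HE. fold X in HE. fold (S s') in HE. fold (S s) in HE.
    (* Gronwall gives the factor [X] for squared distances; [X <= X^2] turns it into the Lipschitz
       constant [X] and avoids a square root. *)
    assert (HX : 1 <= X).
    { unfold X. apply Rle_trans with (exp 0); [rewrite exp_0; lra|]. left. apply exp_increasing.
      apply Rmult_lt_0_compat; [lra|]. apply Rabs_pos_lt. lra. }
    apply Rsqr_incr_0_var; [|apply Rmult_le_pos; [lra|apply Rabs_pos]].
    rewrite Rsqr_mult, <- !Rsqr_abs. unfold Rsqr.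
    assert (0 <= (snd (F s') b - snd (F s) b) ^ 2) by apply pow2_ge_0.
    assert (0 <= (s' - s) ^ 2) by apply pow2_ge_0.
    assert ((s' - s) ^ 2 * X <= (s' - s) ^ 2 * (X * X)) by (apply Rmult_le_compat_l; nra).
    lra. }
  set (s0 := Gmax * (b - a)).
  assert (Hs0 : 0 <= s0) by (unfold s0; nra).
  assert (Hw : forall s t, a <= t <= b -> Rabs (snd (F s) t - s) <= s0).
  { intros s t Ht. destruct (HF s) as [A1 [B1 D1]].
    destruct (mean_value (snd (F s)) (fun t => G t (fst (F s) t) (snd (F s) t)) a t) as [c [Hc Ec]];
      [lra|intros; apply D1|].
    rewrite B1 in Ec. rewrite Ec, Rabs_mult, (Rabs_right (t - a)) by lra.
    unfold s0. apply Rmult_le_compat; [apply Rabs_pos|lra|apply Hmax|lra]. }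
  assert (HSs : forall s, exists c, a <= c <= b /\ S s - M = snd (F s) c * (b - a)).
  { intros s. destruct (HF s) as [A1 [B1 D1]].
    destruct (mean_value (fst (F s)) (snd (F s)) a b) as [c [Hc Ec]]; [lra|intros; apply D1|].
    exists c. split; [exact Hc|]. rewrite A1 in Ec. exact Ec. }
  destruct (IVT_gen S (- s0) s0 M HS) as [s [_ Es]].
  { destruct (HSs s0) as [c [Hc Ec]], (HSs (- s0)) as [c' [Hc' Ec']].
    assert (W1 := Hw s0 c Hc). assert (W2 := Hw (- s0) c' Hc').
    apply Rabs_le_between in W1. apply Rabs_le_between in W2.
    assert (M <= S s0) by nra. assert (S (- s0) <= M) by nra.
    rewrite Rmin_left, Rmax_right by lra. lra. }
  exists (fst (F s)), (snd (F s)). destruct (HF s) as [A1 [B1 D1]].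
  split; [exact A1|split; [exact Es|]]. intros t _. apply D1.
Qed.

Lemma compact_solution k A B e C a b :
  a < b -> 0 < C ->
  (forall t, a <= t <= b -> continuous k t /\ continuous A t /\ continuous B t /\ continuous e t) ->
  (forall t, a <= t <= b -> 1 <= k t /\ 0 < B t /\ C <= e t) ->
  exists v w, solves (riccati k A B e) a b v w /\ forall t, a <= t <= b -> v t <= ln (2 / C).
Proof.
  intros Hab HC Hcont Hpos.
  destruct (compact_bound k a b) as [k1 [Hk1 Hk]]; [lra|intros; now apply Hcont|].
  destruct (compact_bound A a b) as [A1 [HA1 HA]]; [lra|intros; now apply Hcont|].
  destruct (compact_bound B a b) as [B1 [HB1 HB]]; [lra|intros; now apply Hcont|].
  destruct (compact_bound e a b) as [e1 [He1 He]]; [lra|intros; now apply Hcont|].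
  (* On [[a, b]], [exp (- M) = C / 2 < e < e1 + 1 = exp (- m)], so [M] and [m] are strict upper and
     lower levels. The slope level satisfies [K^2 > A1 K + B1 e1]: the quadratic term beats all
     others there. *)
  set (M := ln (2 / C)). set (m := - ln (e1 + 1)). set (K := A1 + B1 * e1 + 1).
  assert (HM : exp (- M) = C / 2).
  { unfold M. rewrite exp_Ropp, exp_ln by (apply Rdiv_lt_0_compat; lra). field. lra. }
  assert (Hm : exp (- m) = e1 + 1).
  { unfold m. rewrite Ropp_involutive. apply exp_ln. lra. }
  assert (Hle : forall t, a <= t <= b -> e t <= e1).
  { intros t Ht. assert (X := Rle_abs (e t)). specialize (He t Ht). lra. }
  assert (HmM : m < M).
  { apply Ropp_lt_cancel, exp_lt_inv. rewrite HM, Hm.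
    specialize (Hpos a ltac:(lra)). specialize (Hle a ltac:(lra)). lra. }
  assert (HBe : 0 <= B1 * e1) by nra.
  assert (HK : 1 <= K) by (unfold K; lra).
  (* Time is clamped too: the coefficients are controlled on [[a, b]] only, while the iteration
     wants bounds on the whole line. *)
  set (G := fun t v p => riccati k A B e (clamp a b t) (clamp m M v) (clamp (- K) K p)).
  assert (Ct : forall t, a <= clamp a b t <= b) by (intros; apply clamp_bounds; lra).
  assert (Cv : forall v, m <= clamp m M v <= M) by (intros; apply clamp_bounds; lra).
  assert (Cp : forall p, Rabs (clamp (- K) K p) <= K).
  { intros p. apply Rabs_le, clamp_bounds. lra. }
  destruct (shooting G (2 * k1 * K + A1 + B1 * exp (- m))
    (k1 * K ^ 2 + A1 * K + B1 * (e1 + exp (- m))) a b M Hab) as [v [w [Va [Vb Hs]]]].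
  - assert (0 < exp (- m)) by apply exp_pos. nra.
  - intros t v w v' w'. unfold G. eapply Rle_trans.
    + apply riccati_lipschitz; [now apply Hk|now apply HA|now apply HB| | | |];
        try apply Cv; apply Cp.
    + apply Rmult_le_compat_l.
      * assert (0 < exp (- m)) by apply exp_pos. nra.
      * apply Rplus_le_compat; apply clamp_lipschitz.
  - intros t v w. apply riccati_bound; [now apply Hk|now apply HA|now apply HB|now apply He| |apply Cp].
    apply Cv.
  - intros v w Hv Hw t. destruct (Hcont _ (Ct t)) as [Ck [CA [CB Ce]]].
    apply (continuous_riccati k A B e (clamp a b) (fun x => clamp m M (v x))
      (fun x => clamp (- K) K (w x))); [apply continuous_clamp|assumption..| |].
    + apply (continuous_comp v (clamp m M)); [apply Hv|apply continuous_clamp].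
    + apply (continuous_comp w (clamp (- K) K)); [apply Hw|apply continuous_clamp].
  - exists v, w.
    assert (vc : forall t, a <= t <= b -> continuity_pt v t).
    { intros t Ht. apply (is_derive_continuity_pt v t (w t)), Hs, Ht. }
    assert (Hup : forall t, a <= t <= b -> v t <= M).
    { destruct (continuity_ab_maj v a b) as [x [Hx Hxab]]; [lra|exact vc|].
      intros t Ht. apply Rle_trans with (v x); [now apply Hx|]. apply Rnot_lt_le. intros Hlt.
      assert (Hin : a < x < b).
      { destruct (Req_dec x a) as [->|]; [lra|]. destruct (Req_dec x b) as [->|]; lra. }
      (* At a maximum above [M] the slope is zero and the clamped value is [M], so the second
         derivative equals [B x (e x - C / 2) > 0], which is impossible. *)
      destruct (interior_max v w (G x (v x) (w x)) a b x Hin) as [W0 Wk];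
        [intros; now apply Hs|now apply Hs|exact Hx|].
      revert Wk. unfold G, riccati. rewrite W0, (clamp_id a b x), (clamp_id (- K) K 0) by lra.
      rewrite clamp_above, HM by lra. specialize (Hpos x Hxab). intros Wk.
      assert (0 < B x * (e x - C / 2)) by (apply Rmult_lt_0_compat; lra). nra. }
    assert (Hlow : forall t, a <= t <= b -> m <= v t).
    { destruct (continuity_ab_maj (fun t => - v t) a b) as [x [Hx Hxab]];
        [lra|intros; now apply continuity_pt_opp, vc|].
      intros t Ht. apply Rle_trans with (v x); [|specialize (Hx t Ht); lra].
      apply Rnot_lt_le. intros Hlt.
      assert (Hin : a < x < b).
      { destruct (Req_dec x a) as [->|]; [lra|]. destruct (Req_dec x b) as [->|]; lra. }
      destruct (interior_max (fun t => - v t) (fun t => - w t) (- G x (v x) (w x)) a b x Hin)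
        as [W0 Wk].
      - intros s Hs'. apply (is_derive_opp v). now apply Hs.
      - apply (is_derive_opp w). now apply Hs.
      - exact Hx.
      - assert (W1 : w x = 0) by lra.
        revert Wk. unfold G, riccati. rewrite W1, (clamp_id a b x), (clamp_id (- K) K 0) by lra.
        rewrite clamp_below, Hm by lra. specialize (Hpos x Hxab). specialize (Hle x Hxab).
        intros Wk.
        assert (0 < B x * (e1 + 1 - e x)) by (apply Rmult_lt_0_compat; lra). nra. }
    (* The sign [s] covers both clamping levels [K] and [- K]. The exponential only lowers the
       expression, so the claim holds for every [x]. *)
    assert (Hslope : forall t s x, a <= t <= b -> s ^ 2 = 1 ->
      riccati k A B e t x (s * K) < 0).
    { intros t s x Ht Hss. unfold riccati.
      specialize (Hpos t Ht). specialize (HA t Ht). specialize (HB t Ht). specialize (Hle t Ht).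
      assert (Pe := exp_pos (- x)).
      replace ((s * K) ^ 2) with (K ^ 2) by (rewrite Rpow_mult_distr, Hss; ring).
      assert (B t <= B1) by (assert (X := Rle_abs (B t)); lra).
      assert (T1 : - A t * (s * K) <= A1 * K).
      { eapply Rle_trans; [apply Rle_abs|].
        assert (Hs1 : Rabs s = 1).
        { rewrite <- pow2_abs in Hss. assert (X := Rabs_pos s). nra. }
        rewrite !Rabs_mult, Rabs_Ropp, Hs1, (Rabs_right K) by lra.
        rewrite Rmult_1_l. apply Rmult_le_compat_r; lra. }
      assert (T2 : B t * (e t - exp (- x)) <= B1 * e1).
      { apply Rle_trans with (B t * e1); [apply Rmult_le_compat_l; lra|].
        apply Rmult_le_compat_r; lra. }
      assert (T3 : K ^ 2 <= k t * K ^ 2) by (assert (0 <= K ^ 2) by apply pow2_ge_0; nra).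
      assert (T4 : A1 * K + B1 * e1 < K ^ 2) by (unfold K in *; nra).
      lra. }
    destruct (boundary_max_slopes v w a b M Hab) as [Wa Wb];
      [apply Hs; lra|apply Hs; lra|exact Va|exact Vb|exact Hup|].
    assert (HwK : forall t, a <= t <= b -> w t <= K).
    { apply (barrier_forward w (fun t => G t (v t) (w t))); [intros; now apply Hs|lra|].
      intros t Ht Hlt. unfold G. rewrite (clamp_id a b t) by lra.
      rewrite (clamp_above (- K) K) by lra. rewrite <- (Rmult_1_l K).
      apply Hslope; [lra|ring]. }
    assert (HwK' : forall t, a <= t <= b -> - w t <= K).
    { apply (barrier_backward (fun t => - w t) (fun t => - G t (v t) (w t)));
        [intros; apply (is_derive_opp w); now apply Hs|lra|].
      intros t Ht Hlt. unfold G. rewrite (clamp_id a b t) by lra.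
      rewrite (clamp_below (- K) K) by lra.
      assert (riccati k A B e t (clamp m M (v t)) (-1 * K) < 0) by (apply Hslope; [lra|ring]).
      replace (-1 * K) with (- K) in H by ring. lra. }
    split; [|exact Hup]. intros t Ht. destruct (Hs t Ht) as [D1 D2]. split; [exact D1|].
    unfold G in D2. rewrite (clamp_id a b), (clamp_id m M), (clamp_id (- K) K) in D2; [exact D2| | |].
    + specialize (HwK t Ht). specialize (HwK' t Ht). lra.
    + specialize (Hup t Ht). specialize (Hlow t Ht). lra.
    + exact Ht.
Qed.

(* Interior estimates that do not depend on the solution: since [k >= 1], [p = v'] obeys
   [p' <= - p^2 - A p + B e], which forces [(t - c) p] and [- (d - t) p] to stay bounded. *)
Lemma riccati_local_bounds k A B e c c' d' d :
  c < c' -> c' < d' -> d' < d ->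
  (forall t, c <= t <= d -> continuous k t /\ continuous A t /\ continuous B t /\ continuous e t) ->
  (forall t, c <= t <= d -> 1 <= k t /\ 0 < B t) ->
  exists m K, 0 <= K /\ forall v w, solves (riccati k A B e) c d v w ->
    forall t, c' <= t <= d' -> m <= v t /\ Rabs (w t) <= K.
Proof.
  intros Hcc Hcd Hdd Hcont Hpos.
  destruct (compact_bound A c d) as [A1 [HA1 HA]]; [lra|intros; now apply Hcont|].
  destruct (compact_bound (fun t => B t * e t) c d) as [D [HD HBe]]; [lra| |].
  { intros t Ht. destruct (Hcont t Ht) as [_ [_ [CB Ce]]].
    apply (continuous_mult (K := R_AbsRing) B e t CB Ce). }
  destruct (compact_bound (fun t => / B t) c d) as [Bi [HBi HB]]; [lra| |].
  { intros t Ht. destruct (Hcont t Ht) as [_ [_ [CB _]]].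
    apply continuity_pt_filterlim, continuity_pt_inv; [now apply continuity_pt_filterlim|].
    specialize (Hpos t Ht). lra. }
  (* For [z = s x p] as in [Hbar], [x] times the derivative of [x p] is at most
     [z - z^2 + A1 l z + l^2 D]. This is negative once [z > N], because then [z >= 1] and
     [z^2 > N z]. *)
  set (l := d - c). set (N := 2 + A1 * l + l ^ 2 * D).
  assert (Hl : 0 < l) by (unfold l; lra).
  assert (HN : 2 <= N).
  { assert (0 <= A1 * l) by nra. assert (0 <= l ^ 2 * D) by (apply Rmult_le_pos; [nra|lra]).
    unfold N. lra. }
  set (K := N / (c' - c) + N / (d - d')).
  assert (P1 : 0 < N / (c' - c)) by (apply Rdiv_lt_0_compat; lra).
  assert (P2 : 0 < N / (d - d')) by (apply Rdiv_lt_0_compat; lra).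
  assert (HK : 0 < K) by (unfold K; lra).
  (* [Q] will bound [B exp (- v)] at one point, and [Bi] converts this into a bound on [exp (- v)];
     the added 1 in [Q'] keeps the argument of [ln] positive. *)
  set (Q := A1 * K + D + 2 * K / (d' - c')).
  assert (HQ : 0 <= Q).
  { assert (0 <= 2 * K / (d' - c')) by (apply Rdiv_le_0_compat; lra). unfold Q. nra. }
  set (Q' := Q * Bi + 1).
  assert (HQ' : 0 < Q') by (unfold Q'; nra).
  exists (- ln Q' - K * (d' - c')), K. split; [lra|]. intros v w Hs.
  (* [s = 1], [x = t - c] or [s = -1], [x = d - t] *)
  assert (Hbar : forall t s x, c <= t <= d -> s ^ 2 = 1 -> 0 < x <= l -> N < s * (x * w t) ->
    s * w t + x * riccati k A B e t (v t) (w t) < 0).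
  { intros t s x Ht Hss Hx Hlt. unfold riccati.
    specialize (Hpos t Ht). specialize (HA t Ht). specialize (HBe t Ht).
    set (z := s * (x * w t)) in *.
    assert (Hz : x * w t = s * z).
    { unfold z. replace (s * (s * (x * w t))) with (s ^ 2 * (x * w t)) by ring. rewrite Hss. ring. }
    assert (Hs1 : Rabs s = 1).
    { rewrite <- pow2_abs in Hss. assert (X := Rabs_pos s). nra. }
    assert (Hmul : x * (s * w t + x * (- k t * w t ^ 2 - A t * w t + B t * (e t - exp (- v t)))) < 0).
    { replace (x * (s * w t + x * (- k t * w t ^ 2 - A t * w t + B t * (e t - exp (- v t)))))
        with (z - k t * (x * w t) ^ 2 - A t * x * (x * w t) + x ^ 2 * (B t * e t)
              - x ^ 2 * (B t * exp (- v t))) by (unfold z; ring).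
      rewrite Hz, Rpow_mult_distr, Hss, Rmult_1_l.
      assert (T1 : - (A t * x * (s * z)) <= A1 * l * z).
      { eapply Rle_trans; [apply Rle_abs|]. rewrite Rabs_Ropp, !Rabs_mult, Hs1, Rmult_1_l.
        rewrite (Rabs_right z), (Rabs_right x) by lra.
        apply Rmult_le_compat_r; [lra|]. apply Rmult_le_compat; try lra. apply Rabs_pos. }
      assert (T2 : x ^ 2 * (B t * e t) <= l ^ 2 * D).
      { apply Rle_trans with (x ^ 2 * D).
        - apply Rmult_le_compat_l; [apply pow2_ge_0|]. assert (X := Rle_abs (B t * e t)). lra.
        - apply Rmult_le_compat_r; [lra|]. apply pow_incr. lra. }
      assert (T3 : 0 <= x ^ 2 * (B t * exp (- v t))).
      { apply Rmult_le_pos; [apply pow2_ge_0|]. assert (X := exp_pos (- v t)). nra. }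
      assert (T4 : z ^ 2 <= k t * z ^ 2) by (assert (0 <= z ^ 2) by apply pow2_ge_0; nra).
      assert (T5 : N * z < z ^ 2) by nra.
      assert (T6 : l ^ 2 * D <= l ^ 2 * D * z).
      { assert (0 <= l ^ 2 * D) by (apply Rmult_le_pos; [apply pow2_ge_0|lra]). nra. }
      unfold N in T5. lra. }
    apply Rnot_le_lt. intros Hge. apply Rle_not_lt in Hmul; [exact Hmul|].
    apply Rmult_le_pos; lra. }
  assert (U1 : forall t, c <= t <= d -> (t - c) * w t <= N).
  { apply (barrier_forward (fun t => (t - c) * w t)
      (fun t => 1 * w t + (t - c) * riccati k A B e t (v t) (w t))).
    - intros t Ht. apply (is_derive_mult (fun t => t - c) w t).
      + auto_derive; [exact I|ring].
      + now apply Hs.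
      + intros; apply Rmult_comm.
    - rewrite Rminus_eq_0. lra.
    - intros t Ht Hlt. apply Hbar; [lra|ring|unfold l; lra|lra]. }
  assert (U2 : forall t, c <= t <= d -> - ((d - t) * w t) <= N).
  { apply (barrier_backward (fun t => - ((d - t) * w t))
      (fun t => - (-1 * w t + (d - t) * riccati k A B e t (v t) (w t)))).
    - intros t Ht. apply (is_derive_opp (fun t => (d - t) * w t)).
      apply (is_derive_mult (fun t => d - t) w t).
      + auto_derive; [exact I|ring].
      + now apply Hs.
      + intros; apply Rmult_comm.
    - rewrite Rminus_eq_0. lra.
    - intros t Ht Hlt.
      assert (-1 * w t + (d - t) * riccati k A B e t (v t) (w t) < 0)
        by (apply Hbar; [lra|ring|unfold l; lra|lra]). lra. }
  assert (HwK : forall t, c' <= t <= d' -> Rabs (w t) <= K).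
  { intros t Ht. specialize (U1 t ltac:(lra)). specialize (U2 t ltac:(lra)).
    assert (E1 : N = (c' - c) * (N / (c' - c))) by (field; lra).
    assert (E2 : N = (d - d') * (N / (d - d'))) by (field; lra).
    apply Rabs_le. unfold K. split.
    - apply Rnot_lt_le. intros H. nra.
    - apply Rnot_lt_le. intros H. nra. }
  (* At this point [x] the derivative of [w] is at least [- 2 K / (d' - c')], so [exp (- v x)]
     cannot be large. The slope bound [K] then carries the lower bound from [x] to all of
     [[c', d']]. *)
  destruct (mean_value w (fun t => riccati k A B e t (v t) (w t)) c' d') as [x [Hx Ex]];
    [lra|intros; apply Hs; lra|].
  assert (Hvx : - ln Q' <= v x).
  { assert (Hlow : - (2 * K / (d' - c')) <= riccati k A B e x (v x) (w x)).
    { assert (Y1 := HwK c' ltac:(lra)). assert (Y2 := HwK d' ltac:(lra)).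
      apply Rabs_le_between in Y1. apply Rabs_le_between in Y2.
      apply Rmult_le_reg_r with (d' - c'); [lra|].
      rewrite <- Ex. replace (- (2 * K / (d' - c')) * (d' - c')) with (- (2 * K)) by (field; lra).
      lra. }
    unfold riccati in Hlow.
    specialize (Hpos x ltac:(lra)). specialize (HA x ltac:(lra)). specialize (HBe x ltac:(lra)).
    specialize (HB x ltac:(lra)). specialize (HwK x Hx).
    assert (T1 : - (A x * w x) <= A1 * K).
    { eapply Rle_trans; [apply Rle_abs|]. rewrite Rabs_Ropp, Rabs_mult.
      apply Rmult_le_compat; try apply Rabs_pos; assumption. }
    assert (T2 : 0 <= k x * w x ^ 2) by (apply Rmult_le_pos; [lra|apply pow2_ge_0]).
    assert (T3 : B x * exp (- v x) <= Q).
    { unfold Q. assert (X := Rle_abs (B x * e x)). lra. }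
    assert (T4 : exp (- v x) <= Q').
    { rewrite Rabs_right in HB by (left; apply Rinv_0_lt_compat; lra).
      replace (exp (- v x)) with (B x * exp (- v x) * / B x) by (field; lra).
      assert (0 < / B x) by (apply Rinv_0_lt_compat; lra).
      unfold Q'. apply Rle_trans with (Q * Bi); [|lra].
      apply Rmult_le_compat; try lra. assert (X := exp_pos (- v x)). nra. }
    assert (T5 : - v x <= ln Q').
    { rewrite <- (ln_exp (- v x)). apply ln_le; [apply exp_pos|exact T4]. }
    lra. }
  intros t Ht. split; [|now apply HwK].
  assert (Hvar : Rabs (v t - v x) <= K * (d' - c')).
  { assert (V : forall p q, c' <= p <= d' -> c' <= q <= d' -> p <= q ->
      Rabs (v q - v p) <= K * (d' - c')).
    { intros p q Hp Hq Hpq.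
      destruct (mean_value v w p q Hpq) as [y [Hy Ey]]; [intros; apply Hs; lra|].
      rewrite Ey, Rabs_mult, (Rabs_right (q - p)) by lra.
      apply Rmult_le_compat; [apply Rabs_pos|lra|apply HwK; lra|lra]. }
    destruct (Rle_dec x t).
    - apply V; lra.
    - rewrite Rabs_minus_sym. apply V; lra. }
  apply Rabs_le_between in Hvar. lra.
Qed.

(** * Exhaustion, extraction and passage to the limit *)

(** The bound by [al O] makes every approximating interval contain the first one. The term of index
    0 also serves later to pick a point strictly between the end and [y0]. *)
Lemma lower_exhaustion lo y0 :
  Rbar_lt lo (Finite y0) ->
  exists al : nat -> R,
    (forall n, Rbar_lt lo (al n) /\ al n <= al O /\ al n < y0) /\
    (forall y, Rbar_lt lo (Finite y) -> exists N, forall n, (N <= n)%nat -> al n < y).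
Proof.
  destruct lo as [l| |]; simpl; intros Hl; [| contradiction |].
  - exists (fun n => l + (y0 - l) / (INR n + 2)). split.
    + intros n. assert (P := pos_INR n).
      assert (H1 : 0 < (y0 - l) / (INR n + 2)) by (apply Rdiv_lt_0_compat; lra).
      assert (E : y0 - l = (INR n + 2) * ((y0 - l) / (INR n + 2))) by (field; lra).
      replace (INR 0 + 2) with 2 by (simpl; ring).
      set (z := (y0 - l) / (INR n + 2)) in *.
      repeat split; try lra; nra.
    + intros y Hy. destruct (INR_unbounded ((y0 - l) / (y - l))) as [N HN].
      exists N. intros n Hn. apply le_INR in Hn. assert (P := pos_INR n).
      assert (E : y0 - l = (y - l) * ((y0 - l) / (y - l))) by (field; lra).
      assert (E' : y0 - l = (INR n + 2) * ((y0 - l) / (INR n + 2))) by (field; lra).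
      set (z := (y0 - l) / (INR n + 2)) in *. set (z' := (y0 - l) / (y - l)) in *.
      assert (y0 - l < (INR n + 2) * (y - l)) by nra.
      apply Rnot_le_lt. intros H'. nra.
  - exists (fun n => y0 - 1 - INR n). split.
    + intros n. assert (P := pos_INR n). simpl. repeat split; lra.
    + intros y _. destruct (INR_unbounded (y0 - y)) as [N HN].
      exists N. intros n Hn. apply le_INR in Hn. lra.
Qed.

Lemma upper_exhaustion hi y0 :
  Rbar_lt (Finite y0) hi ->
  exists be : nat -> R,
    (forall n, Rbar_lt (be n) hi /\ be O <= be n /\ y0 < be n) /\
    (forall y, Rbar_lt (Finite y) hi -> exists N, forall n, (N <= n)%nat -> y < be n).
Proof.
  intros H. destruct (lower_exhaustion (Rbar_opp hi) (- y0)) as [al [H1 H2]].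
  { destruct hi; simpl in *; try lra; try exact I; contradiction. }
  exists (fun n => - al n). split.
  - intros n. destruct (H1 n) as [A1 [A2 A3]]. repeat split; [|lra|lra].
    destruct hi; simpl in *; try lra; try exact I; contradiction.
  - intros y Hy. destruct (H2 (- y)) as [N HN].
    { destruct hi; simpl in *; try lra; try exact I; contradiction. }
    exists N. intros n Hn. specialize (HN n Hn). lra.
Qed.

(** Each index is chosen separately near one cluster point; [n <= phi n] already sends the indices
    to infinity. The explicit rate survives composition with a second extraction. *)
Lemma bounded_extraction (x : nat -> R) K :
  (forall n, Rabs (x n) <= K) ->
  exists (phi : nat -> nat) l, (forall n, (n <= phi n)%nat) /\
    forall n, Rabs (x (phi n) - l) < / (INR n + 1).
Proof.
  intros Hx.
  destruct (Bolzano_Weierstrass x (fun c => - K <= c <= K) (compact_P3 (- K) K)) as [l Hl].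
  { intros n. apply Rabs_le_between, Hx. }
  destruct (functional_choice
    (fun n p => (n <= p)%nat /\ Rabs (x p - l) < / (INR n + 1))) as [phi Hphi].
  { intros n. assert (Hp : 0 < / (INR n + 1)).
    { apply Rinv_0_lt_compat. assert (P := pos_INR n). lra. }
    destruct (Hl (disc l (mkposreal _ Hp)) n) as [p Hpp].
    - exists (mkposreal _ Hp). intros y Hy. exact Hy.
    - now exists p. }
  exists phi, l. split; intros n; apply Hphi.
Qed.

Lemma bounded_pair_extraction (x y : nat -> R) K K' :
  (forall n, Rabs (x n) <= K) -> (forall n, Rabs (y n) <= K') ->
  exists phi : nat -> nat, (forall n, (n <= phi n)%nat) /\
    forall eps, 0 < eps -> exists N, forall p q, (N <= p)%nat -> (N <= q)%nat ->
      Rabs (x (phi p) - x (phi q)) < eps /\ Rabs (y (phi p) - y (phi q)) < eps.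
Proof.
  intros Hx Hy.
  destruct (bounded_extraction x K Hx) as [phi [l [P1 P2]]].
  destruct (bounded_extraction (fun n => y (phi n)) K') as [psi [l' [Q1 Q2]]]; [intros; apply Hy|].
  exists (fun n => phi (psi n)). split.
  { intros n. apply Nat.le_trans with (psi n); [apply Q1|apply P1]. }
  intros eps He. destruct (INR_unbounded (2 / eps)) as [N HN]. exists N.
  assert (S : forall n z m u, (N <= n)%nat -> (n <= m)%nat -> Rabs (z - u) < / (INR m + 1) ->
     Rabs (z - u) < eps / 2).
  { intros n z m u Hn Hm H. eapply Rlt_trans; [exact H|].
    apply Nat.le_trans with (1 := Hn) in Hm. apply le_INR in Hm.
    assert (0 < 2 / eps) by (apply Rdiv_lt_0_compat; lra).
    replace (eps / 2) with (/ (2 / eps)) by (field; lra).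
    apply Rinv_lt_contravar; [apply Rmult_lt_0_compat; lra|lra]. }
  intros p q Hp Hq. split.
  - assert (A1 := S p _ _ _ Hp (Q1 p) (P2 (psi p))). assert (A2 := S q _ _ _ Hq (Q1 q) (P2 (psi q))).
    apply Rabs_def2 in A1. apply Rabs_def2 in A2. apply Rabs_def1; lra.
  - assert (A1 := S p _ _ _ Hp (Nat.le_refl p) (Q2 p)). assert (A2 := S q _ _ _ Hq (Nat.le_refl q) (Q2 q)).
    apply Rabs_def2 in A1. apply Rabs_def2 in A2. apply Rabs_def1; lra.
Qed.

Lemma CVU_limit_ge u g c d t m :
  CVU u g c d -> Boule c d t -> (forall n, m <= u n t) -> m <= g t.
Proof.
  intros H Ht Hm. apply Rnot_lt_le. intros Hlt.
  destruct (H (m - g t) ltac:(lra)) as [N HN]. specialize (HN N t (le_n N) Ht).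
  specialize (Hm N). apply Rabs_def2 in HN. lra.
Qed.

Theorem riccati_global_solution lo hi y0 (k A B e : R -> R) C :
  0 < C -> in_interval lo hi y0 ->
  (forall t, in_interval lo hi t ->
     continuous k t /\ continuous A t /\ continuous B t /\ continuous e t) ->
  (forall t, in_interval lo hi t -> 1 <= k t /\ 0 < B t /\ C <= e t) ->
  exists v w, forall t, in_interval lo hi t ->
    is_derive v t (w t) /\ is_derive w t (riccati k A B e t (v t) (w t)).
Proof.
  intros HC [Hlo Hhi] Hcont Hpos.
  assert (HI : forall a b t, Rbar_lt lo (Finite a) -> Rbar_lt (Finite b) hi ->
    a <= t <= b -> in_interval lo hi t).
  { intros a b t Ha Hb Ht. split.
    - apply Rbar_lt_le_trans with (Finite a); [exact Ha|simpl; lra].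
    - apply Rbar_le_lt_trans with (Finite b); [simpl; lra|exact Hb]. }
  destruct (lower_exhaustion lo y0 Hlo) as [al [Hal1 Hal2]].
  destruct (upper_exhaustion hi y0 Hhi) as [be [Hbe1 Hbe2]].
  set (F := riccati k A B e).
  destruct (functional_choice (fun n (z : (R -> R) * (R -> R)) =>
     solves F (al n) (be n) (fst z) (snd z) /\
     forall t, al n <= t <= be n -> fst z t <= ln (2 / C))) as [Z HZ].
  { intros n. destruct (Hal1 n) as [P1 [_ P2]], (Hbe1 n) as [Q1 [_ Q2]].
    destruct (compact_solution k A B e C (al n) (be n)) as [v [w Hvw]];
      [lra|exact HC| | |now exists (v, w)];
      intros t Ht; [apply Hcont|apply Hpos]; exact (HI _ _ t P1 Q1 Ht). }
  set (V := fun n => fst (Z n)). set (W := fun n => snd (Z n)).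
  assert (Hlocal : forall c' d', Rbar_lt lo (Finite c') -> Rbar_lt (Finite d') hi -> c' < d' ->
    exists c d m K, Rbar_lt lo (Finite c) /\ Rbar_lt (Finite d) hi /\ c < c' /\ d' < d /\ 0 <= K /\
      forall n, al n <= c -> d <= be n ->
        solves F c d (V n) (W n) /\
        forall t, c' <= t <= d' -> m <= V n t <= ln (2 / C) /\ Rabs (W n t) <= K).
  { intros c' d' Hc' Hd' Hcd.
    destruct (lower_exhaustion lo c' Hc') as [c [Hc _]]. specialize (Hc O).
    destruct (upper_exhaustion hi d' Hd') as [d [Hd _]]. specialize (Hd O).
    destruct (riccati_local_bounds k A B e (c O) c' d' (d O)) as [m [K [HK H]]];
      [lra|lra|lra| | |].
    - intros t Ht. apply Hcont. now apply (HI (c O) (d O)).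
    - intros t Ht. assert (X := Hpos t (HI (c O) (d O) t ltac:(apply Hc) ltac:(apply Hd) Ht)). lra.
    - exists (c O), (d O), m, K. repeat (split; [first [lra|apply Hc|apply Hd]|]).
      intros n Hac Hdb. destruct (HZ n) as [S1 S2].
      assert (S3 : solves F (c O) (d O) (V n) (W n)) by (now apply (solves_sub F (al n) (be n))).
      split; [exact S3|]. intros t Ht. destruct (H (V n) (W n) S3 t Ht) as [B1 B2].
      split; [split; [exact B1|apply S2; lra]|exact B2]. }
  (* The local estimate is applied on [[al O, be O]], which lies in the domain of every
     approximation, so the bound holds for all [n] and not just eventually. *)
  assert (Hb : exists K, forall n, Rabs (V n y0) <= K /\ Rabs (W n y0) <= K).
  { destruct (Hal1 O) as [P1 [_ P2]], (Hbe1 O) as [Q1 [_ Q2]].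
    destruct (riccati_local_bounds k A B e (al O) ((al O + y0) / 2) ((y0 + be O) / 2) (be O))
      as [m [K [HK H]]]; [lra|lra|lra| | |].
    - intros t Ht. apply Hcont. now apply (HI (al O) (be O)).
    - intros t Ht. assert (X := Hpos t (HI (al O) (be O) t P1 Q1 Ht)). lra.
    - exists (Rabs m + Rabs (ln (2 / C)) + K). intros n.
      destruct (Hal1 n) as [P1' [P2' P3']], (Hbe1 n) as [Q1' [Q2' Q3']], (HZ n) as [S1 S2].
      destruct (H (V n) (W n)) with (t := y0) as [B1 B2];
        [now apply (solves_sub F (al n) (be n))|lra|].
      specialize (S2 y0 ltac:(lra)). fold (V n) in S2.
      assert (X1 := Rabs_pos m). assert (X2 := Rabs_pos (ln (2 / C))).
      assert (X3 := Rle_abs (ln (2 / C))). assert (X4 := Rle_abs (- m)). rewrite Rabs_Ropp in X4.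
      split; [apply Rabs_le; lra|lra]. }
  destruct Hb as [K0 HK0].
  destruct (bounded_pair_extraction (fun n => V n y0) (fun n => W n y0) K0 K0)
    as [phi [Hphi Hcauchy]]; [intros; apply HK0|intros; apply HK0|].
  exists (fun t => real (Lim_seq (fun n => V (phi n) t))),
    (fun t => real (Lim_seq (fun n => W (phi n) t))).
  set (v := fun t => real (Lim_seq (fun n => V (phi n) t))).
  set (w := fun t => real (Lim_seq (fun n => W (phi n) t))).
  intros t0 [Hlo0 Hhi0].
  (* The compact interval must contain [y0] besides [t0]: Gronwall propagates the convergence of the
     Cauchy data from [y0]. *)
  assert (Hc' : exists c', Rbar_lt lo (Finite c') /\ c' < t0 /\ c' < y0).
  { destruct (lower_exhaustion lo (Rmin t0 y0)) as [c [Hc _]].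
    - unfold Rmin; destruct Rle_dec; assumption.
    - exists (c O). destruct (Hc O) as [X1 [_ X2]]. split; [exact X1|].
      assert (Y1 := Rmin_l t0 y0). assert (Y2 := Rmin_r t0 y0). lra. }
  assert (Hd' : exists d', Rbar_lt (Finite d') hi /\ t0 < d' /\ y0 < d').
  { destruct (upper_exhaustion hi (Rmax t0 y0)) as [d [Hd _]].
    - unfold Rmax; destruct Rle_dec; assumption.
    - exists (d O). destruct (Hd O) as [X1 [_ X2]]. split; [exact X1|].
      assert (Y1 := Rmax_l t0 y0). assert (Y2 := Rmax_r t0 y0). lra. }
  destruct Hc' as [c' [Hc1 [Hc2 Hc3]]], Hd' as [d' [Hd1 [Hd2 Hd3]]].
  destruct (Hlocal c' d' Hc1 Hd1 ltac:(lra)) as [c [d [m [K [Hc [Hd [Hcc [Hdd [HK Hn]]]]]]]]].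
  assert (HN : exists N, forall n, (N <= n)%nat -> al (phi n) <= c /\ be (phi n) >= d).
  { destruct (Hal2 c Hc) as [N1 H1], (Hbe2 d Hd) as [N2 H2]. exists (N1 + N2)%nat.
    intros n Hle. assert (X := Hphi n).
    specialize (H1 (phi n) ltac:(lia)). specialize (H2 (phi n) ltac:(lia)). lra. }
  destruct HN as [N HN].
  assert (Hsol : forall n, (N <= n)%nat -> solves F c d (V (phi n)) (W (phi n)) /\
    forall t, c' <= t <= d' -> m <= V (phi n) t <= ln (2 / C) /\ Rabs (W (phi n) t) <= K).
  { intros n Hle. destruct (HN n Hle). apply Hn; lra. }
  assert (HI' : forall t, c' <= t <= d' -> in_interval lo hi t) by (intros t; now apply HI).
  destruct (compact_bound k c' d') as [k1 [Hk1 Hk]]; [lra|intros; now apply Hcont, HI'|].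
  destruct (compact_bound A c' d') as [A1 [HA1 HA]]; [lra|intros; now apply Hcont, HI'|].
  destruct (compact_bound B c' d') as [B1 [HB1 HB]]; [lra|intros; now apply Hcont, HI'|].
  set (L := 2 * k1 * K + A1 + B1 * exp (- m)).
  assert (HL : 0 <= L).
  { assert (0 < exp (- m)) by apply exp_pos. unfold L.
    assert (0 <= k1 * K) by now apply Rmult_le_pos.
    assert (0 <= B1 * exp (- m)) by (apply Rmult_le_pos; lra). lra. }
  assert (Hr : 0 < (d' - c') / 2) by lra.
  set (x0 := (c' + d') / 2). set (r := mkposreal _ Hr).
  assert (HBo : forall t, Boule x0 r t -> c' <= t <= d').
  { intros t Ht. unfold Boule in Ht. simpl in Ht. apply Rabs_def2 in Ht. unfold x0 in Ht. lra. }
  assert (Hunif : forall eps, 0 < eps -> exists N', forall p q t, (N' <= p)%nat -> (N' <= q)%nat ->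
    Boule x0 r t -> Rabs (V (phi p) t - V (phi q) t) <= eps /\ Rabs (W (phi p) t - W (phi q) t) <= eps).
  { intros eps He. set (X := exp ((1 + 3 * L) * (d' - c'))).
    assert (HX : 1 <= X).
    { unfold X. apply Rle_trans with (exp 0); [rewrite exp_0; lra|].
      left. apply exp_increasing. apply Rmult_lt_0_compat; lra. }
    (* With data closer than [eps' = eps / (2 X)], the squared distance is at most
       [2 eps'^2 X <= (2 X eps')^2 = eps^2], by [X >= 1]. *)
    assert (He' : 0 < eps / (2 * X)) by (apply Rdiv_lt_0_compat; lra).
    destruct (Hcauchy _ He') as [N' HN']. exists (N + N')%nat. intros p q t Hp Hq Ht.
    apply HBo in Ht.
    destruct (Hsol p ltac:(lia)) as [Sp Bp], (Hsol q ltac:(lia)) as [Sq Bq].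
    assert (HE := gronwall_pair (V (phi p)) (W (phi p)) (fun t => F t (V (phi p) t) (W (phi p) t))
      (V (phi q)) (W (phi q)) (fun t => F t (V (phi q) t) (W (phi q) t)) c' d' L HL
      ltac:(intros; apply Sp; lra) ltac:(intros; apply Sq; lra)).
    specialize (HE ltac:(intros s Hs; apply riccati_lipschitz;
      [now apply Hk|now apply HA|now apply HB|now apply Bp|now apply Bq|now apply Bp|now apply Bq])
      y0 t ltac:(lra) Ht).
    destruct (HN' p q ltac:(lia) ltac:(lia)) as [E1 E2].
    set (eps' := eps / (2 * X)) in *.
    assert (Ee : eps = 2 * X * eps') by (unfold eps'; field; lra).
    assert (HEX : exp ((1 + 3 * L) * Rabs (t - y0)) <= X).
    { assert (Ha : Rabs (t - y0) <= d' - c') by (apply Rabs_le; lra).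
      assert (Hb : (1 + 3 * L) * Rabs (t - y0) <= (1 + 3 * L) * (d' - c'))
        by (apply Rmult_le_compat_l; lra).
      unfold X. destruct Hb as [Hb| ->]; [left; now apply exp_increasing|right; reflexivity]. }
    assert (Hsq : forall z, Rabs z < eps' -> z ^ 2 <= eps' ^ 2).
    { intros z Hz. rewrite <- pow2_abs. apply pow_incr. split; [apply Rabs_pos|lra]. }
    apply Hsq in E1. apply Hsq in E2.
    assert (HE2 : (V (phi p) t - V (phi q) t) ^ 2 + (W (phi p) t - W (phi q) t) ^ 2 <= eps ^ 2).
    { eapply Rle_trans; [exact HE|].
      apply Rle_trans with ((2 * eps' ^ 2) * X).
      - apply Rmult_le_compat; [|left; apply exp_pos|lra|exact HEX].
        apply Rplus_le_le_0_compat; apply pow2_ge_0.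
      - rewrite Ee. assert (Y : 0 <= eps' ^ 2) by apply pow2_ge_0.
        replace ((2 * X * eps') ^ 2) with (eps' ^ 2 * (4 * X ^ 2)) by ring.
        replace (2 * eps' ^ 2 * X) with (eps' ^ 2 * (2 * X)) by ring.
        apply Rmult_le_compat_l; [exact Y|]. nra. }
    assert (Y1 : 0 <= (V (phi p) t - V (phi q) t) ^ 2) by apply pow2_ge_0.
    assert (Y2 : 0 <= (W (phi p) t - W (phi q) t) ^ 2) by apply pow2_ge_0.
    assert (Hrt : forall z, z ^ 2 <= eps ^ 2 -> Rabs z <= eps).
    { intros z Hz. apply Rabs_le. split; nra. }
    split; apply Hrt; lra. }
  assert (CV : CVU (fun n => V (phi n)) v x0 r).
  { apply (CVU_of_cauchy (fun n => V (phi n))). intros eps He. destruct (Hunif eps He) as [N' HN'].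
    exists N'. intros p q t Hp Hq Ht. now apply HN'. }
  assert (CW : CVU (fun n => W (phi n)) w x0 r).
  { apply (CVU_of_cauchy (fun n => W (phi n))). intros eps He. destruct (Hunif eps He) as [N' HN'].
    exists N'. intros p q t Hp Hq Ht. now apply HN'. }
  (* Dropping the first [N] terms makes the local bounds valid for every index, as [CVU_lipschitz]
     requires. *)
  apply (CVU_shift _ _ _ _ N) in CV. apply (CVU_shift _ _ _ _ N) in CW.
  set (V' := fun n => V (phi (n + N)%nat)) in *. set (W' := fun n => W (phi (n + N)%nat)) in *.
  assert (Hsol' : forall n, solves F c d (V' n) (W' n) /\
    forall t, c' <= t <= d' -> m <= V' n t <= ln (2 / C) /\ Rabs (W' n t) <= K).
  { intros n. apply Hsol. lia. }
  (* The right-hand side is Lipschitz only where [v >= m] and [|w| <= K], so the limit has to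
     satisfy these bounds as well. *)
  assert (Hvm : forall t, Boule x0 r t -> m <= v t).
  { intros t Ht. apply (CVU_limit_ge V' v x0 r t m CV Ht).
    intros n. apply Hsol'. now apply HBo. }
  assert (HwK : forall t, Boule x0 r t -> Rabs (w t) <= K).
  { intros t Ht.
    assert (Hlim : is_lim_seq (fun n => Rabs (W' n t)) (Rabs (w t))).
    { apply (is_lim_seq_abs (fun n => W' n t) (w t)). apply is_lim_seq_Reals.
      now apply (CVU_Un_cv W' w x0 r). }
    apply (is_lim_seq_le (fun n => Rabs (W' n t)) (fun _ => K) (Rabs (w t)) K);
      [|exact Hlim|apply is_lim_seq_const].
    intros n. apply Hsol'. now apply HBo. }
  assert (Ht0 : Boule x0 r t0).
  { unfold Boule, x0. simpl. apply Rabs_def1; lra. }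
  split; apply is_derive_Reals.
  - apply (CVU_derivable V' W' v w x0 r CW); [| |exact Ht0].
    + intros x Hx. now apply (CVU_Un_cv V' v x0 r).
    + intros n x Hx. apply HBo in Hx. apply is_derive_Reals. apply Hsol'. lra.
  - apply (CVU_derivable W' (fun n t => F t (V' n t) (W' n t)) w (fun t => F t (v t) (w t)) x0 r);
      [| | |exact Ht0].
    + apply (CVU_lipschitz V' W' _ v w _ x0 r L HL CV CW).
      intros n t Ht. assert (Ht' := HBo t Ht).
      apply riccati_lipschitz; [now apply Hk|now apply HA|now apply HB|now apply Hsol'|
        now apply Hvm|now apply Hsol'|now apply HwK].
    + intros x Hx. now apply (CVU_Un_cv W' w x0 r).
    + intros n x Hx. apply HBo in Hx. apply is_derive_Reals. apply Hsol'. lra.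
Qed.

(** * Return from [v] to [f] *)

Lemma in_interval_locally lo hi y : in_interval lo hi y -> locally y (in_interval lo hi).
Proof.
  intros [Hl Hh].
  destruct (lower_exhaustion lo y Hl) as [c [Hc _]], (upper_exhaustion hi y Hh) as [d [Hd _]].
  destruct (Hc O) as [Hc1 [_ Hc2]], (Hd O) as [Hd1 [_ Hd2]].
  assert (He : 0 < Rmin (y - c O) (d O - y)) by (apply Rmin_pos; lra).
  exists (mkposreal _ He). intros x Hx.
  change (Rabs (x - y) < Rmin (y - c O) (d O - y)) in Hx.
  assert (X1 := Rmin_l (y - c O) (d O - y)). assert (X2 := Rmin_r (y - c O) (d O - y)).
  apply Rabs_def2 in Hx. split.
  - apply Rbar_lt_trans with (Finite (c O)); [exact Hc1|simpl; lra].
  - apply Rbar_lt_trans with (Finite (d O)); [simpl; lra|exact Hd1].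
Qed.

Lemma loc_lipschitz_continuity_pt lo hi g y :
  loc_lipschitz_on lo hi g -> in_interval lo hi y -> continuity_pt g y.
Proof.
  intros Hg Hy. destruct (Hg y Hy) as [eps [L [He H]]].
  destruct (in_interval_locally lo hi y Hy) as [d Hd].
  apply continuity_pt_filterlim.
  apply (lipschitz_continuous g L y (Rmin eps d)).
  - apply Rmin_pos; [exact He|apply cond_pos].
  - intros x Hx. assert (X1 := Rmin_l eps d). assert (X2 := Rmin_r eps d).
    apply H; [|exact Hy|lra|rewrite Rminus_eq_0, Rabs_R0; lra].
    apply Hd. change (Rabs (x - y) < d). lra.
Qed.

Lemma exp_substitution lo hi (Rc : R) (v w h : R -> R) :
  (forall t, in_interval lo hi t -> is_derive v t (w t) /\ is_derive w t (h t)) ->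
  (forall t, in_interval lo hi t -> continuous h t) ->
  let f := fun t => exp (Rc * v t) in
  C2_on lo hi f /\
  forall t, in_interval lo hi t ->
    Derive f t = Rc * w t * f t /\
    Derive (Derive f) t = (Rc * h t + (Rc * w t) ^ 2) * f t.
Proof.
  intros Hd Hh f.
  assert (D1 : forall t, in_interval lo hi t -> is_derive f t (Rc * w t * f t)).
  { intros t Ht. destruct (Hd t Ht) as [Dv _]. unfold f. auto_derive.
    - eexists; exact Dv.
    - replace (Derive (fun x => v x) t) with (w t) by (symmetry; apply is_derive_unique, Dv). ring. }
  assert (D2' : forall t, in_interval lo hi t -> is_derive (fun t => Rc * w t * f t) t
      ((Rc * h t + (Rc * w t) ^ 2) * f t)).
  { intros t Ht. destruct (Hd t Ht) as [Dv Dw]. unfold f. auto_derive.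
    - repeat split; eexists; eassumption.
    - replace (Derive (fun x => v x) t) with (w t) by (symmetry; apply is_derive_unique, Dv).
      replace (Derive (fun x => w x) t) with (h t) by (symmetry; apply is_derive_unique, Dw). ring. }
  (* The formula for [Derive f] holds inside the interval only; openness makes it an identity near
     each point, which is enough to differentiate it again. *)
  assert (E1 : forall t, in_interval lo hi t -> locally t (fun s => Rc * w s * f s = Derive f s)).
  { intros t Ht. generalize (in_interval_locally lo hi t Ht). apply filter_imp.
    intros s Hs. symmetry. now apply is_derive_unique, D1. }
  assert (D2 : forall t, in_interval lo hi t ->
    is_derive (Derive f) t ((Rc * h t + (Rc * w t) ^ 2) * f t)).
  { intros t Ht. apply (is_derive_ext_loc (fun t => Rc * w t * f t)); [now apply E1|now apply D2']. }
  split.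
  - intros t Ht. split; [|split].
    + eexists. now apply D1.
    + eexists. now apply D2.
    + apply (continuous_ext_loc (Derive (Derive f)) (fun s => (Rc * h s + (Rc * w s) ^ 2) * f s)).
      * generalize (in_interval_locally lo hi t Ht). apply filter_imp.
        intros s Hs. symmetry. now apply is_derive_unique, D2.
      * assert (Ch := proj2 (continuity_pt_filterlim h t) (Hh t Ht)).
        assert (Cw := is_derive_continuity_pt w t _ (proj2 (Hd t Ht))).
        assert (Cf := is_derive_continuity_pt f t _ (D1 t Ht)).
        apply continuity_pt_filterlim.
        assert (Cc : forall z, continuity_pt (fct_cte z) t)
          by (intros z; apply continuity_pt_const; intros ? ?; reflexivity).
        (* The trailing [fct_cte 1] comes from the unfolding of [pow] at exponent 2. *)
        change (continuity_pt ((fct_cte Rc * h +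
          (fct_cte Rc * w) * ((fct_cte Rc * w) * fct_cte 1)) * f)%F t).
        apply continuity_pt_mult; [apply continuity_pt_plus|exact Cf];
          repeat first [assumption|apply Cc|apply continuity_pt_mult].
  - intros s Hs. split; apply is_derive_unique; [now apply D1|now apply D2].
Qed.

Theorem theorem4p3
  (lo hi : Rbar) (hE : Rbar_lt lo hi)
  (r lam sigma a b rho delta : R -> R) (Rc : R)
  (hr : loc_lipschitz_on lo hi r) (hlam : loc_lipschitz_on lo hi lam)
  (hsig : loc_lipschitz_on lo hi sigma) (ha : loc_lipschitz_on lo hi a)
  (hb : loc_lipschitz_on lo hi b) (hrho : loc_lipschitz_on lo hi rho)
  (hdelta : loc_lipschitz_on lo hi delta)
  (hsig_pos : forall y, in_interval lo hi y -> 0 < sigma y)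
  (hb_nz : forall y, in_interval lo hi y -> b y <> 0)
  (hrho_bd : forall y, in_interval lo hi y -> -1 <= rho y <= 1)
  (hR : 1 < Rc)
  (hwp : exists C, 0 < C /\
          forall y, in_interval lo hi y -> C <= eta_fun Rc r lam delta y) :
  exists f : R -> R,
    (forall y, in_interval lo hi y -> 0 < f y) /\
    C2_on lo hi f /\
    (forall y, in_interval lo hi y ->
       0 = 1 / 2 * (b y) ^ 2 * Derive (Derive f) y
           + atilde_fun Rc a rho lam b y * Derive f y
           - Rc * eta_fun Rc r lam delta y * f y
           + Rc * Rpower (f y) (1 - 1 / Rc)
           + 1 / 2 * ((1 - Rc) / Rc) * (rho y) ^ 2 * (b y) ^ 2
               * ((Derive f y) ^ 2 / f y)).
Proof.
  destruct hwp as [C [HC Heta]].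
  (* Division by [Rc b^2 f / 2] leaves [w^2] with the coefficient [Rc] from [f''] and
     [(1 - Rc) rho^2] from the term [f'^2 / f]. *)
  set (k := fun y => Rc - (Rc - 1) * rho y ^ 2).
  set (B := fun y => 2 / b y ^ 2).
  set (A := fun y => B y * atilde_fun Rc a rho lam b y).
  set (e := eta_fun Rc r lam delta).
  assert (Hb2 : forall y, in_interval lo hi y -> 0 < b y ^ 2).
  { intros y Hy. apply pow2_gt_0. now apply hb_nz. }
  assert (Hcont : forall t, in_interval lo hi t ->
    continuous k t /\ continuous A t /\ continuous B t /\ continuous e t).
  { intros t Ht.
    assert (Cr := loc_lipschitz_continuity_pt lo hi r t hr Ht).
    assert (Cl := loc_lipschitz_continuity_pt lo hi lam t hlam Ht).
    assert (Ca := loc_lipschitz_continuity_pt lo hi a t ha Ht).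
    assert (Cb := loc_lipschitz_continuity_pt lo hi b t hb Ht).
    assert (Cp := loc_lipschitz_continuity_pt lo hi rho t hrho Ht).
    assert (Cd := loc_lipschitz_continuity_pt lo hi delta t hdelta Ht).
    assert (Cc : forall z, continuity_pt (fct_cte z) t)
      by (intros z; apply continuity_pt_const; intros ? ?; reflexivity).
    assert (CB : continuity_pt B t).
    { change (continuity_pt (fct_cte 2 / (b * (b * fct_cte 1)))%F t).
      apply continuity_pt_div; [apply Cc| |].
      - repeat first [assumption|apply Cc|apply continuity_pt_mult].
      - specialize (Hb2 t Ht). unfold mult_fct, fct_cte. simpl in Hb2. lra. }
    split; [|split; [|split]]; apply continuity_pt_filterlim.
    - change (continuity_pt (fct_cte Rc - fct_cte (Rc - 1) * (rho * (rho * fct_cte 1)))%F t).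
      apply continuity_pt_minus; repeat first [assumption|apply Cc|apply continuity_pt_mult].
    - change (continuity_pt (B * (a + fct_cte ((1 - Rc) / Rc) * rho * lam * b))%F t).
      apply continuity_pt_mult; [exact CB|].
      apply continuity_pt_plus; repeat first [assumption|apply Cc|apply continuity_pt_mult].
    - exact CB.
    - change (continuity_pt (fct_cte (/ Rc) * (delta - fct_cte (1 - Rc) *
        (r + (lam * (lam * fct_cte 1)) * fct_cte (/ (2 * Rc)))))%F t).
      apply continuity_pt_mult; [apply Cc|]. apply continuity_pt_minus; [exact Cd|].
      apply continuity_pt_mult; [apply Cc|]. apply continuity_pt_plus; [exact Cr|].
      repeat first [assumption|apply Cc|apply continuity_pt_mult]. }
  assert (Hpos : forall t, in_interval lo hi t -> 1 <= k t /\ 0 < B t /\ C <= e t).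
  { intros t Ht. split; [|split; [|now apply Heta]].
    (* Here [Rc > 1] and [|rho| <= 1] combine: [k = 1 + (Rc - 1) (1 - rho^2)]. *)
    - specialize (hrho_bd t Ht). assert (rho t ^ 2 <= 1) by nra. unfold k. nra.
    - apply Rdiv_lt_0_compat; [lra|now apply Hb2]. }
  assert (Hy0 : exists y0, in_interval lo hi y0).
  { destruct lo as [l| |], hi as [h| |]; simpl in hE; try contradiction.
    - exists ((l + h) / 2). split; simpl; lra.
    - exists (l + 1). split; simpl; [lra|exact I].
    - exists (h - 1). split; simpl; [exact I|lra].
    - exists 0. split; exact I. }
  destruct Hy0 as [y0 Hy0].
  destruct (riccati_global_solution lo hi y0 k A B e C HC Hy0 Hcont Hpos) as [v [w Hvw]].
  set (f := fun t => exp (Rc * v t)).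
  destruct (exp_substitution lo hi Rc v w (fun t => riccati k A B e t (v t) (w t)) Hvw)
    as [HC2 Hder].
  { intros t Ht. destruct (Hcont t Ht) as [Ck [CA [CB Ce]]].
    apply (continuous_riccati k A B e (fun x => x) v w t); try assumption.
    - apply continuous_id.
    - apply (ex_derive_continuous v t). exists (w t). exact (proj1 (Hvw t Ht)).
    - apply (ex_derive_continuous w t). eexists. exact (proj2 (Hvw t Ht)). }
  exists f. split; [|split; [exact HC2|]].
  - intros y _. apply exp_pos.
  - intros y Hy. destruct (Hder y Hy) as [D1 D2].
    change (Derive f y = Rc * w y * f y) in D1.
    change (Derive (Derive f) y =
      (Rc * riccati k A B e y (v y) (w y) + (Rc * w y) ^ 2) * f y) in D2.
    rewrite D1, D2.
    assert (Hf : 0 < f y) by apply exp_pos.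
    assert (Hpow : Rpower (f y) (1 - 1 / Rc) = f y * exp (- v y)).
    { unfold Rpower, f. rewrite ln_exp, <- exp_plus. f_equal. field. lra. }
    rewrite Hpow. unfold riccati, A, B, k. fold e. specialize (Hb2 y Hy).
    assert (b y <> 0) by now apply hb_nz.
    field. repeat split; lra.
Qed.
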